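(* Let $\epsilon>0$ and $\Omega,\gamma\in\mathbb{R}$, and consider the coupled system $$\left\{\begin{array}{l} i\,\frac{dA_n}{d\tau}=\epsilon(A_{n+1}-2A_n+A_{n-1})+\Omega A_n+\gamma(\bar B_n-\bar A_n)+\frac12|A_n|^2A_n,\\ i\,\frac{dB_n}{d\tau}=\epsilon(B_{n+1}-2B_n+B_{n-1})+\Omega B_n+\gamma(\bar A_n-\bar B_n)+\frac12|B_n|^2B_n,\end{array}\right.\qquad n\in\mathbb{Z}.$$ For $\Omega\notin[0,4\epsilon]$ define $$\gamma_0:=\left\{\begin{array}{ll}\frac12(\Omega-4\epsilon),&\Omega>4\epsilon,\\ \frac12|\Omega|,&\Omega<0.\end{array}\right.$$ Then: (i) if $\Omega\notin[0,4\epsilon]$ and $|\gamma|<\gamma_0$, the zero equilibrium $A=B=0$ is linearly stable; (ii) if $\Omega\notin[0,4\epsilon]$ and $|\gamma|\ge\gamma_0$, the zero equilibrium is linearly unstable; (iii) if $\Omega\in[0,4\epsilon]$ and $\gamma\ne0$, the zero equilibrium is linearly unstable.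
   Context: The unknowns $A_n(\tau),B_n(\tau)$ are complex-valued, the bar denotes complex conjugation, and $\tau\in\mathbb{R}$ is time. The linearization at the zero equilibrium is the system obtained by dropping the cubic terms $\frac12|A_n|^2A_n$ and $\frac12|B_n|^2B_n$; it is a bounded real-linear evolution equation on $\ell^2(\mathbb{Z})\times\ell^2(\mathbb{Z})$ (square-summable complex sequences). The zero equilibrium is called linearly stable if there is a constant $K$ such that every solution of the linearized system with initial data in $\ell^2(\mathbb{Z})\times\ell^2(\mathbb{Z})$ satisfies $\|A(\tau)\|_{\ell^2}+\|B(\tau)\|_{\ell^2}\le K(\|A(0)\|_{\ell^2}+\|B(0)\|_{\ell^2})$ for all $\tau\in\mathbb{R}$, and linearly unstable otherwise (so both exponential and polynomial growth of perturbations count as instability). *)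

(* Defs.v *)
From HB Require Import structures.
From mathcomp Require Import all_boot all_order all_algebra.
From mathcomp Require Import all_classical all_reals all_analysis.
From mathcomp Require Import complex.

Set Implicit Arguments.
Unset Strict Implicit.
Unset Printing Implicit Defensive.

Import Order.TTheory GRing.Theory Num.Theory.
Import numFieldNormedType.Exports.

Local Open Scope classical_set_scope.
Local Open Scope complex_scope.
Local Open Scope ring_scope.

Definition l2_energy (R : realType) (u : int -> R[i]) : \bar R :=
  (\esum_(n in [set: int]) ((ComplexField.Normc.normc (u n)) ^+ 2)%:E)%E.

Definition in_l2 (R : realType) (u : int -> R[i]) : Prop :=
  (l2_energy u < +oo)%E.

(* Equal to the l^2 norm on l^2; its value is meaningless (zero) elsewhere, so
   it is only used together with [in_l2]. *)
Definition l2norm (R : realType) (u : int -> R[i]) : R :=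
  Num.sqrt (fine (l2_energy u)).

(* The derivative at [t] of the l^2-valued curve [A], in the norm of l^2 (not
   merely componentwise).  For curves in l^2 the difference quotients, and hence
   all the arguments of [l2norm], are in l^2. *)
Definition is_l2_derive (R : realType)
    (A : R -> int -> R[i]) (t : R) (dA : int -> R[i]) : Prop :=
  in_l2 dA /\
  l2norm (fun n => (h^-1)%:C * (A (t + h) n - A t n) - dA n)
    @[h --> (0 : R)^'] --> (0 : R).

(* Both systems below are invariant under exchanging A and B, so a single map
   [F] describes them: i A' = F A B and i B' = F B A. *)
Definition l2_solution (R : realType)
    (F : (int -> R[i]) -> (int -> R[i]) -> int -> R[i])
    (A B : R -> int -> R[i]) : Prop :=
  (forall t : R, in_l2 (A t) /\ in_l2 (B t)) /\
  exists dA dB : R -> int -> R[i],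
    forall t : R,
      [/\ is_l2_derive A t (dA t), is_l2_derive B t (dB t),
          forall n : int, 'i * dA t n = F (A t) (B t) n
        & forall n : int, 'i * dB t n = F (B t) (A t) n].

Definition linearized_rhs (R : realType) (eps Omega gamma : R)
    (X Y : int -> R[i]) (n : int) : R[i] :=
  eps%:C * (X (n + 1) - 2 * X n + X (n - 1)) + Omega%:C * X n
  + gamma%:C * (conjc (Y n) - conjc (X n)).

Definition coupled_rhs (R : realType) (eps Omega gamma : R)
    (X Y : int -> R[i]) (n : int) : R[i] :=
  linearized_rhs eps Omega gamma X Y n + 2^-1 * `|X n| ^+ 2 * X n.

Definition zero_linearly_stable (R : realType) (eps Omega gamma : R) : Prop :=
  exists K : R, forall A B : R -> int -> R[i],
    l2_solution (linearized_rhs eps Omega gamma) A B ->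
    forall t : R,
      l2norm (A t) + l2norm (B t) <= K * (l2norm (A 0) + l2norm (B 0)).

Definition zero_linearly_unstable (R : realType) (eps Omega gamma : R) : Prop :=
  ~ zero_linearly_stable eps Omega gamma.

(* Only meaningful when [Omega] is outside [0, 4 eps]. *)
Definition gamma0 (R : realType) (eps Omega : R) : R :=
  if 4 * eps < Omega then (Omega - 4 * eps) / 2 else `|Omega| / 2.

Lemma l2_energy0 (R : realType) : l2_energy (fun=> 0 : R[i]) = 0%E.
Proof.
by rewrite /l2_energy esum1// => n _; rewrite ComplexField.Normc.normc0 expr0n.
Qed.

Lemma zero_equilibrium (R : realType) (eps Omega gamma : R) :
  l2_solution (coupled_rhs eps Omega gamma) (fun _ _ => 0) (fun _ _ => 0).
Proof.
have l20 : in_l2 (fun=> 0 : R[i]) by rewrite /in_l2 l2_energy0 ltry.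
have d0 t : is_l2_derive (fun (_ : R) _ => 0 : R[i]) t (fun=> 0).
  split=> //.
  under eq_fun do under eq_fun do rewrite !subr0 mulr0.
  by rewrite /l2norm l2_energy0 /= sqrtr0; exact: cvg_cst.
have F0 n : coupled_rhs eps Omega gamma (fun=> 0) (fun=> 0) n = 0.
  by rewrite /coupled_rhs /linearized_rhs rmorph0 !(mulr0, subr0, addr0).
split=> //; exists (fun _ _ => 0), (fun _ _ => 0) => t.
by split=> // n; rewrite F0 mulr0.
Qed.

(* Main.v *)
(** Put D = A - B = u + i v and S = A + B, and let L = eps Delta + Omega, a
    self-adjoint operator with spectrum [[Omega - 4 eps, Omega]].  The linear
    system decouples into u' = (L + c) v, v' = - (L - c) u with c = 2 gamma for
    D and c = 0 for S.  The form <(L - c) u, u> + <(L + c) v, v> is conserved,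
    and it is definite when |c| lies below the distance from 0 to the spectrum
    of L; this gives stability.

    Conversely let lambda be in the spectrum with |lambda| <= |c|, c <> 0.
    Testing a solution that starts at an approximate eigenvector phi of L
    against phi gives alpha = <u, phi>, beta = <v, phi> with
    alpha' = (lambda + c) beta and beta' = (c - lambda) alpha up to small errors.
    The product sgn(c) alpha beta then increases at a rate bounded below as
    long as alpha and beta stay bounded, which contradicts stability.  For phi
    one takes a plane wave damped by r^|n|; data bounded by r^|n| also make the
    power series of the flow converge componentwise under the summable majorant
    C_t r^|n|, so that the required l^2-differentiable solutions exist. *)
Require Import Defs.
From HB Require Import structures.
From mathcomp Require Import all_boot all_order all_algebra.
From mathcomp Require Import all_classical all_reals all_analysis.
From mathcomp Require Import complex.
From mathcomp Require Import ring lra zify.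

Import Order.TTheory GRing.Theory Num.Theory.
Import numFieldNormedType.Exports.

Local Open Scope classical_set_scope.
Local Open Scope ring_scope.

(** * Signed sums of absolutely summable families *)

Section Sums.
Context {R : realType} {T : choiceType}.
Implicit Types f g : T -> R.

Definition summ f := (\esum_(n in [set: T]) `|f n|%:E < +oo)%E.

(* Meaningful only when [summ f] holds, because [fine +oo = 0]. *)
Definition sumT f : R :=
  fine (\esum_(n in [set: T]) (Num.max (f n) 0)%:E)
  - fine (\esum_(n in [set: T]) (Num.max (- f n) 0)%:E).

Lemma summ_le f g : (forall n, `|f n| <= `|g n|) -> summ g -> summ f.
Proof.
by move=> fg; apply: le_lt_trans; apply: le_esum => n _; rewrite lee_fin.
Qed.

Lemma summ_leD f g h : (forall n, `|h n| <= `|f n| + `|g n|) ->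
  summ f -> summ g -> summ h.
Proof.
move=> hfg sf sg; apply: le_lt_trans (lte_add_pinfty sf sg).
rewrite -esumD//.
by apply: le_esum => n _; rewrite -EFinD lee_fin.
Qed.

Lemma summD f g : summ f -> summ g -> summ (fun n => f n + g n).
Proof. by apply: summ_leD => n; rewrite ler_normD. Qed.

Lemma summN f : summ f -> summ (fun n => - f n).
Proof. by apply: summ_le => n; rewrite normrN. Qed.

Lemma esum_fineK f : (forall n, 0 <= f n) -> summ f ->
  (\esum_(n in [set: T]) (f n)%:E
   = (fine (\esum_(n in [set: T]) (f n)%:E))%:E)%E.
Proof.
move=> f0; rewrite /summ; under eq_esum do rewrite ger0_norm//.
move=> sf; rewrite fineK// fin_numElt sf andbT.
by apply: lt_le_trans (ltNyr 0) _; apply: esum_ge0 => n _; rewrite lee_fin.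
Qed.

Lemma fine_esumD f g : (forall n, 0 <= f n) -> (forall n, 0 <= g n) ->
  summ f -> summ g ->
  fine (\esum_(n in [set: T]) (f n + g n)%:E)%E
  = fine (\esum_(n in [set: T]) (f n)%:E)%E
    + fine (\esum_(n in [set: T]) (g n)%:E)%E.
Proof.
move=> f0 g0 sf sg; under eq_esum do rewrite EFinD.
rewrite esumD; last 2 first.
- by move=> n _; rewrite lee_fin.
- by move=> n _; rewrite lee_fin.
by rewrite esum_fineK// (esum_fineK g)// -EFinD.
Qed.

Lemma sumT_ge0E f : (forall n, 0 <= f n) ->
  sumT f = fine (\esum_(n in [set: T]) (f n)%:E)%E.
Proof.
move=> f0; rewrite /sumT [X in _ - fine X]esum1 ?subr0; last first.
  by move=> n _; rewrite max_r// oppr_le0.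
by congr fine; apply: eq_esum => n _; rewrite max_l.
Qed.

Lemma sumT_ge0 f : (forall n, 0 <= f n) -> 0 <= sumT f.
Proof.
move=> f0; rewrite sumT_ge0E// fine_ge0// esum_ge0// => n _.
by rewrite lee_fin.
Qed.

(** Any splitting into nonnegative summable families computes [sumT], because
    [max(p - q, 0) + q = max(q - p, 0) + p] termwise and [esum] is additive on nonnegative terms.
    Linearity of [sumT] rests on this freedom. *)
Lemma sumT_sub p q : (forall n, 0 <= p n) -> (forall n, 0 <= q n) ->
  summ p -> summ q ->
  sumT (fun n => p n - q n)
  = fine (\esum_(n in [set: T]) (p n)%:E)%E
    - fine (\esum_(n in [set: T]) (q n)%:E)%E.
Proof.
move=> p0 q0 sp sq; apply/eqP; rewrite /sumT subr_eq addrAC eq_sym subr_eq.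
apply/eqP; have spq : summ (fun n => p n - q n).
  exact: summD sp (summN _ sq).
have max0 (x : R) : `|Num.max x 0| <= `|x|.
  by rewrite /Num.max; case: ifP => //; rewrite normr0.
have m0 (x : R) : 0 <= Num.max x 0 by rewrite le_max lexx orbT.
have spos : summ (fun n => Num.max (p n - q n) 0).
  by apply: summ_le spq => n; exact: max0.
have sneg : summ (fun n => Num.max (- (p n - q n)) 0).
  by apply: summ_le spq => n; apply: le_trans (max0 _) _; rewrite normrN.
rewrite -(fine_esumD _ _ (fun n => m0 _) q0 spos sq).
rewrite -(fine_esumD _ _ p0 (fun n => m0 _) sp sneg).
congr fine; apply: eq_esum => n _; congr EFin.
by rewrite /Num.max; do 2 case: ifP; lra.
Qed.

Lemma summ_pos f : summ f -> summ (fun n => Num.max (f n) 0).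
Proof.
by apply: summ_le => n; rewrite /Num.max; case: ifP => //; rewrite normr0.
Qed.

Lemma summ_neg f : summ f -> summ (fun n => Num.max (- f n) 0).
Proof. by move=> /summN /summ_pos. Qed.

Lemma max_subNE (x : R) : Num.max x 0 - Num.max (- x) 0 = x.
Proof. by rewrite /Num.max; do 2 case: ifP; lra. Qed.

Lemma eq_sumT f g : f =1 g -> sumT f = sumT g.
Proof. by move=> /funext ->. Qed.

Lemma sumTD f g : summ f -> summ g ->
  sumT (fun n => f n + g n) = sumT f + sumT g.
Proof.
move=> sf sg.
have m0 (x : R) : 0 <= Num.max x 0 by rewrite le_max lexx orbT.
rewrite -(eq_sumT (fun n => (Num.max (f n) 0 + Num.max (g n) 0)
    - (Num.max (- f n) 0 + Num.max (- g n) 0))); last first.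
  by move=> n; have := max_subNE (f n); have := max_subNE (g n); lra.
rewrite sumT_sub; last 4 first.
- by move=> n; rewrite addr_ge0.
- by move=> n; rewrite addr_ge0.
- by apply: summD; exact: summ_pos.
- by apply: summD; exact: summ_neg.
rewrite (fine_esumD _ _ (fun n => m0 (f n)) (fun n => m0 (g n))
  (summ_pos _ sf) (summ_pos _ sg)).
rewrite (fine_esumD _ _ (fun n => m0 (- f n)) (fun n => m0 (- g n))
  (summ_neg _ sf) (summ_neg _ sg)).
by rewrite /sumT; ring.
Qed.

Lemma sumTN f : sumT (fun n => - f n) = - sumT f.
Proof.
rewrite /sumT opprB; congr (_ - _); congr fine.
by apply: eq_esum => n _; rewrite opprK.
Qed.

(** Each finite partial sum scales by [c], which gives one inequality; [fine_esumZ] obtains the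
    reverse one by applying it to [c^-1] and the family [c * f n]. *)
Lemma esumZ_le (c : R) f : 0 <= c -> (forall n, 0 <= f n) ->
  (\esum_(n in [set: T]) (c * f n)%:E
   <= c%:E * \esum_(n in [set: T]) (f n)%:E)%E.
Proof.
move=> c0 f0; apply: ge_ereal_sup => _ [X [finX _] <-].
under eq_fsbigr do rewrite EFinM.
rewrite -ge0_mule_fsumr; last by move=> n; rewrite lee_fin.
rewrite lee_wpmul2l ?lee_fin//; apply: ereal_sup_ubound.
by exists X.
Qed.

Lemma summZ (c : R) f : summ f -> summ (fun n => c * f n).
Proof.
rewrite /summ => sf; under eq_esum do rewrite normrM.
have /le_lt_trans := esumZ_le `|c| (fun n => `|f n|) (normr_ge0 _)
  (fun n => normr_ge0 _); apply.
rewrite (esum_fineK (fun n => `|f n|))//.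
- by rewrite -EFinM ltry.
- by rewrite /summ; under eq_esum do rewrite normr_id.
Qed.

Lemma fine_esumZ (c : R) f : 0 <= c -> (forall n, 0 <= f n) -> summ f ->
  fine (\esum_(n in [set: T]) (c * f n)%:E)%E
  = c * fine (\esum_(n in [set: T]) (f n)%:E)%E.
Proof.
rewrite le_eqVlt => /predU1P[<-|c0] f0 sf.
  by rewrite mul0r esum1// => n _; rewrite mul0r.
have cf0 n : 0 <= c * f n by rewrite mulr_ge0// ltW.
have := esumZ_le c f (ltW c0) f0.
have := esumZ_le c^-1 (fun n => c * f n) _ cf0.
rewrite invr_ge0 (ltW c0) => /(_ isT).
under eq_esum do rewrite mulKf ?gt_eqF//.
rewrite (esum_fineK f)// (esum_fineK (fun n => c * f n))//; last exact: summZ.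
rewrite -!EFinM !lee_fin mulrC ler_pdivlMr// => h1 h2 /=.
by apply/eqP; rewrite eq_le h2/= mulrC.
Qed.

Lemma sumTZ (c : R) f : summ f -> sumT (fun n => c * f n) = c * sumT f.
Proof.
move=> sf.
wlog c0 : c / 0 <= c.
  move=> h; have [/h//|cN] := leP 0 c.
  rewrite -(eq_sumT (fun n => - (- c * f n))); last by move=> n; ring.
  by rewrite sumTN h ?mulNr ?opprK// oppr_ge0 ltW.
rewrite -(eq_sumT (fun n => c * Num.max (f n) 0 - c * Num.max (- f n) 0));
  last by move=> n; rewrite -mulrBr max_subNE.
have m0 (x : R) : 0 <= Num.max x 0 by rewrite le_max lexx orbT.
rewrite sumT_sub; last 4 first.
- by move=> n; rewrite mulr_ge0.
- by move=> n; rewrite mulr_ge0.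
- by apply/summZ/summ_pos.
- by apply/summZ/summ_neg.
rewrite (fine_esumZ _ _ c0 (fun n => m0 (f n)) (summ_pos _ sf)).
by rewrite (fine_esumZ _ _ c0 (fun n => m0 (- f n)) (summ_neg _ sf)) -mulrBr.
Qed.

Lemma ler_sumT f g : summ f -> summ g -> (forall n, f n <= g n) ->
  sumT f <= sumT g.
Proof.
move=> sf sg fg; rewrite -subr_ge0 -sumTN -sumTD//; last exact: summN.
by apply: sumT_ge0 => n; rewrite subr_ge0.
Qed.

End Sums.

Lemma summ_reindex {R : realType} {T : choiceType} (e : T -> T) (f : T -> R) :
  bijective e -> summ f -> summ (f \o e).
Proof.
move=> be; rewrite /summ => sf.
rewrite -(reindex_esum setT setT e (fun n => `|f n|%:E))//.
by rewrite setTT_bijective.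
Qed.

Lemma sumT_reindex {R : realType} {T : choiceType} (e : T -> T) (f : T -> R) :
  bijective e -> sumT (f \o e) = sumT f.
Proof.
move=> be; rewrite /sumT; congr (fine _ - fine _).
  rewrite [RHS](reindex_esum setT setT e)//.
  by rewrite setTT_bijective.
rewrite [RHS](reindex_esum setT setT e)//.
by rewrite setTT_bijective.
Qed.

(** * Real l^2 inner product *)

Section InnerProduct.
Context {R : realType} {T : choiceType}.
Implicit Types u v w : T -> R.

Definition sqsumm u := summ (fun n => u n ^+ 2).

Definition ip u v : R := sumT (fun n => u n * v n).

Definition nrm u : R := Num.sqrt (ip u u).

Lemma sqsumm_le u v : (forall n, `|u n| <= `|v n|) -> sqsumm v -> sqsumm u.
Proof. by move=> uv; apply: summ_le => n; rewrite !normrX lerXn2r ?nnegrE. Qed.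

Lemma summ_mul u v : sqsumm u -> sqsumm v -> summ (fun n => u n * v n).
Proof.
apply: summ_leD => n; rewrite normrM !normrX.
have := sqr_ge0 (`|u n| - `|v n|); rewrite sqrrB mulr2n.
move: (sqr_ge0 `|u n|) (sqr_ge0 `|v n|).
by move: (`|u n|) (`|v n|) => a b; rewrite !expr2; lra.
Qed.

Lemma sqsumm0 : sqsumm (0 : T -> R).
Proof.
rewrite /sqsumm /summ esum1// => n _.
by rewrite [(0 : T -> R) n]/(0) expr0n normr0.
Qed.

Lemma sqsummD u v : sqsumm u -> sqsumm v -> sqsumm (u + v).
Proof.
move=> su sv.
have := summD _ _ (summZ 2 _ su) (summZ 2 _ sv).
apply: summ_le => n /=; have -> : (u + v) n = u n + v n by [].
have := sqr_ge0 (u n - v n); have := sqr_ge0 (u n); have := sqr_ge0 (v n).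
move=> *; rewrite ger0_norm ?sqr_ge0// ger0_norm; nra.
Qed.

Lemma sqsummZ (c : R) u : sqsumm u -> sqsumm (c *: u).
Proof.
move=> /(summZ (c ^+ 2)); apply: summ_le => n.
by have -> : (c *: u) n = c * u n by []; rewrite exprMn.
Qed.

Lemma sqsummN u : sqsumm u -> sqsumm (- u).
Proof.
by apply: sqsumm_le => n; have -> : (- u) n = - u n by []; rewrite normrN.
Qed.

Lemma sqsummB u v : sqsumm u -> sqsumm v -> sqsumm (u - v).
Proof. by move=> su /sqsummN; exact: sqsummD. Qed.

Lemma ipC u v : ip u v = ip v u.
Proof. by apply: eq_sumT => n; rewrite mulrC. Qed.

Lemma ipDl u v w : sqsumm u -> sqsumm v -> sqsumm w ->
  ip (u + v) w = ip u w + ip v w.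
Proof.
move=> su sv sw; rewrite /ip -sumTD ?summ_mul//.
by apply: eq_sumT => n; rewrite mulrDl.
Qed.

Lemma ipNl u w : ip (- u) w = - ip u w.
Proof. by rewrite /ip -sumTN; apply: eq_sumT => n; rewrite mulNr. Qed.

Lemma ipZl (c : R) u w : sqsumm u -> sqsumm w -> ip (c *: u) w = c * ip u w.
Proof.
move=> su sw; rewrite /ip -sumTZ ?summ_mul//.
by apply: eq_sumT => n; rewrite mulrA.
Qed.

Lemma ipDr u v w : sqsumm u -> sqsumm v -> sqsumm w ->
  ip w (u + v) = ip w u + ip w v.
Proof. by move=> *; rewrite ipC ipDl// !(ipC w). Qed.

Lemma ipNr u w : ip w (- u) = - ip w u.
Proof. by rewrite ipC ipNl ipC. Qed.

Lemma ipZr (c : R) u w : sqsumm u -> sqsumm w -> ip w (c *: u) = c * ip w u.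
Proof. by move=> *; rewrite ipC ipZl// ipC. Qed.

Lemma ip_ge0 u : 0 <= ip u u.
Proof. by apply: sumT_ge0 => n; rewrite -expr2 sqr_ge0. Qed.

Lemma nrm_ge0 u : 0 <= nrm u. Proof. exact: sqrtr_ge0. Qed.

Lemma sqr_nrm u : nrm u ^+ 2 = ip u u.
Proof. by rewrite sqr_sqrtr// ip_ge0. Qed.

(** Cauchy-Schwarz, from nonnegativity of the quadratic polynomial [t |-> <u + t v, u + t v>]. *)
Lemma ip_sqr_le u v : sqsumm u -> sqsumm v -> ip u v ^+ 2 <= ip u u * ip v v.
Proof.
move=> su sv.
have q (t : R) : 0 <= ip u u + 2 * t * ip u v + t ^+ 2 * ip v v.
  have := ip_ge0 (u + t *: v).
  have stv : sqsumm (t *: v) by exact: sqsummZ.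
  have sutv : sqsumm (u + t *: v) by exact: sqsummD.
  rewrite ipDl// !ipDr// !ipZl// !ipZr//.
  rewrite (ipC v u) => h; apply: le_trans h _.
  by rewrite le_eqVlt; apply/orP; left; apply/eqP; ring.
have := ip_ge0 v; rewrite le_eqVlt => /predU1P[v0|v_gt0].
  have [->|uv0] := eqVneq (ip u v) 0; first by rewrite -v0 mulr0 expr0n.
  (* When [<v, v> = 0] the polynomial is affine in [t], and this [t] would give it the value -1. *)
  have := q (- (ip u u + 1) / (2 * ip u v)).
  rewrite -v0 mulr0 addr0.
  have -> : 2 * (- (ip u u + 1) / (2 * ip u v)) * ip u v = - (ip u u + 1).
    by field.
  by lra.
(* The minimum point of the quadratic. *)
have := q (- ip u v / ip v v).
have -> : ip u u + 2 * (- ip u v / ip v v) * ip u v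
    + (- ip u v / ip v v) ^+ 2 * ip v v = ip u u - ip u v ^+ 2 / ip v v.
  by field; rewrite gt_eqF.
by rewrite subr_ge0 ler_pdivrMr.
Qed.

Lemma normr_ip_le u v : sqsumm u -> sqsumm v -> `|ip u v| <= nrm u * nrm v.
Proof.
move=> su sv; rewrite -ler_sqr ?nnegrE ?mulr_ge0 ?nrm_ge0//.
by rewrite exprMn !sqr_nrm real_normK ?num_real// ip_sqr_le.
Qed.

Lemma nrm_leD u v : sqsumm u -> sqsumm v -> nrm (u + v) <= nrm u + nrm v.
Proof.
move=> su sv; rewrite -ler_sqr ?nnegrE ?addr_ge0 ?nrm_ge0//.
rewrite sqr_nrm sqrrD !sqr_nrm.
have suv : sqsumm (u + v) by exact: sqsummD.
rewrite ipDl// !ipDr// (ipC v u).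
have := normr_ip_le _ _ su sv; rewrite ler_norml => /andP[_].
by rewrite mulr2n; lra.
Qed.

Lemma nrmZ (c : R) u : sqsumm u -> nrm (c *: u) = `|c| * nrm u.
Proof.
move=> su; rewrite /nrm ipZl ?ipZr//; last exact: sqsummZ.
by rewrite mulrA -expr2 sqrtrM ?sqr_ge0// sqrtr_sqr.
Qed.

Lemma ler_ip u v : (forall n, `|u n| <= `|v n|) -> sqsumm v ->
  ip u u <= ip v v.
Proof.
move=> uv sv; have su := sqsumm_le _ _ uv sv.
apply: ler_sumT; try exact: summ_mul.
move=> n; have : `|u n| ^+ 2 <= `|v n| ^+ 2 by rewrite lerXn2r ?nnegrE.
by rewrite !real_normK ?num_real// !expr2.
Qed.

Lemma ler_nrm u v : (forall n, `|u n| <= `|v n|) -> sqsumm v ->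
  nrm u <= nrm v.
Proof. by move=> uv sv; rewrite ler_wsqrtr// ler_ip. Qed.

Lemma sqsumm_reindex (e : T -> T) u :
  bijective e -> sqsumm u -> sqsumm (u \o e).
Proof. by move=> be su; exact: (summ_reindex e (fun n => u n ^+ 2)). Qed.

Lemma ip_reindex (e : T -> T) u v :
  bijective e -> ip (u \o e) (v \o e) = ip u v.
Proof. by move=> be; exact: (sumT_reindex e (fun n => u n * v n)). Qed.

End InnerProduct.

(** * Derivatives of l^2-valued curves *)

Section L2Derivative.
Context {R : realType} {T : choiceType}.
Implicit Types (f g : R -> T -> R) (x y : T -> R).

Definition quot_err f (t : R) x (h : R) : T -> R :=
  h^-1 *: (f (t + h) - f t) - x.

Definition dl2 f t x :=
  sqsumm x /\ nrm (quot_err f t x h) @[h --> (0 : R)^'] --> (0 : R).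

Lemma sqsumm_quot_err f t x h : (forall s, sqsumm (f s)) -> sqsumm x ->
  sqsumm (quot_err f t x h).
Proof. by move=> sf sx; apply: sqsummB => //; apply/sqsummZ/sqsummB. Qed.

Lemma cvg_ip0 (F : set_system R) (r : R -> T -> R) x : Filter F ->
  (forall h, sqsumm (r h)) -> sqsumm x ->
  nrm (r h) @[h --> F] --> (0 : R) -> ip (r h) x @[h --> F] --> (0 : R).
Proof.
move=> FF sr sx r0; apply/norm_cvg0P.
apply: (@squeeze_cvgr _ _ _ _ (cst 0) (fun h => nrm (r h) * nrm x)).
- by apply: nearW => h; rewrite normr_ge0 normr_ip_le.
- exact: cvg_cst.
- by rewrite -[X in _ --> X](mul0r (nrm x)); apply: cvgMr_tmp.
Qed.

Lemma cvg_ip00 (F : set_system R) (r q : R -> T -> R) : Filter F ->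
  (forall h, sqsumm (r h)) -> (forall h, sqsumm (q h)) ->
  nrm (r h) @[h --> F] --> (0 : R) -> nrm (q h) @[h --> F] --> (0 : R) ->
  ip (r h) (q h) @[h --> F] --> (0 : R).
Proof.
move=> FF sr sq r0 q0; apply/norm_cvg0P.
apply: (@squeeze_cvgr _ _ _ _ (cst 0) (fun h => nrm (r h) * nrm (q h))).
- by apply: nearW => h; rewrite normr_ge0 normr_ip_le.
- exact: cvg_cst.
- by rewrite -[X in _ --> X](mul0r 0); apply: cvgM.
Qed.

Lemma is_derive_ip f g t x y :
  (forall s, sqsumm (f s)) -> (forall s, sqsumm (g s)) ->
  dl2 f t x -> dl2 g t y ->
  is_derive t (1 : R) (fun s => ip (f s) (g s)) (ip x (g t) + ip (f t) y).
Proof.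
move=> sf sg [sx fx] [sy gy].
set r := quot_err f t x; set q := quot_err g t y.
have sr h : sqsumm (r h) by exact: sqsumm_quot_err.
have sq h : sqsumm (q h) by exact: sqsumm_quot_err.
have fE h : h != 0 -> f (t + h) = f t + h *: (r h + x).
  move=> h0; rewrite /r /quot_err subrK scalerA divff// scale1r.
  by rewrite [RHS]addrC subrK.
have gE h : h != 0 -> g (t + h) = g t + h *: (q h + y).
  move=> h0; rewrite /q /quot_err subrK scalerA divff// scale1r.
  by rewrite [RHS]addrC subrK.
have {}fx : nrm (r h) @[h --> (0 : R)^'] --> (0 : R) by [].
have {}gy : nrm (q h) @[h --> (0 : R)^'] --> (0 : R) by [].
clearbody r q.
(* The expanded difference quotient of the product: apart from the expected derivative, every term
   carries an error [r h] or [q h] or a factor [h]. *)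
pose e h := (ip x (g t) + ip (f t) y)
  + (ip (r h) (g t) + ip (q h) (f t)
     + h * (ip (r h) (q h) + ip (r h) y + ip (q h) x + ip x y)).
suff : h^-1 *: (((fun s => ip (f s) (g s)) \o shift t) (h *: (1 : R))
    - ip (f t) (g t)) @[h --> (0 : R)^'] --> ip x (g t) + ip (f t) y.
  move=> H; apply: DeriveDef; first by apply/cvg_ex; eexists; exact: H.
  exact: cvg_lim H.
apply: (@cvg_trans _ (e h @[h --> (0 : R)^'])).
  apply: near_eq_cvg; near=> h.
  have h0 : h != 0 by near: h; exact: nbhs_dnbhs_neq.
  have srx : sqsumm (r h + x) by exact: sqsummD.
  have sqy : sqsumm (q h + y) by exact: sqsummD.
  have hrx : sqsumm (h *: (r h + x)) by exact: sqsummZ.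
  have hqy : sqsumm (h *: (q h + y)) by exact: sqsummZ.
  have sgq : sqsumm (g t + h *: (q h + y)) by exact: sqsummD.
  rewrite /= [h *: 1]mulr1 [h + t]addrC fE// gE//.
  rewrite ipDl// !ipDr// !ipZl// !ipZr// !ipDl// !ipDr//.
  rewrite /e (ipC (q h) (f t)) (ipC (q h) x).
  rewrite -[h^-1 *: _]/(h^-1 * _).
  by field.
have lim1 : ip (r h) (g t) + ip (q h) (f t) @[h --> (0 : R)^'] --> 0 + (0 : R).
  by apply: cvgD; exact: cvg_ip0.
have lim2 : h * (ip (r h) (q h) + ip (r h) y + ip (q h) x + ip x y)
    @[h --> (0 : R)^'] --> 0 * (0 + 0 + 0 + ip x y).
  apply: cvgM; first exact: cvg_within.
  apply: cvgD; last exact: cvg_cst.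
  apply: cvgD; last exact: cvg_ip0.
  apply: cvgD; last exact: cvg_ip0.
  exact: cvg_ip00.
have := cvgD (cvg_cst (ip x (g t) + ip (f t) y)) (cvgD lim1 lim2).
by rewrite mul0r !addr0; apply.
Unshelve. all: by end_near. Qed.

Lemma dl2_reindex (k : T -> T) f t x : bijective k ->
  dl2 f t x -> dl2 (fun s => f s \o k) t (x \o k).
Proof.
move=> bk [sx fx]; split; first exact: sqsumm_reindex.
have -> : (fun h => nrm (quot_err (fun s => f s \o k) t (x \o k) h))
  = fun h => nrm (quot_err f t x h) => //.
by apply/funext => h; rewrite /nrm -[in RHS](ip_reindex k).
Qed.

Lemma dl2_cst x t : dl2 (fun=> x) t 0.
Proof.
split; first exact: sqsumm0.
have -> : (fun h => nrm (quot_err (fun=> x) t 0 h)) = cst 0.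
  apply/funext => h; rewrite /quot_err !subrr scaler0 subr0.
  by rewrite -(scale0r (0 : T -> R)) nrmZ ?normr0 ?mul0r//; exact: sqsumm0.
exact: cvg_cst.
Qed.

Lemma dl2D f g t x y :
  (forall s, sqsumm (f s)) -> (forall s, sqsumm (g s)) ->
  dl2 f t x -> dl2 g t y -> dl2 (f + g) t (x + y).
Proof.
move=> sf sg [sx fx] [sy gy]; split; first exact: sqsummD.
apply: (@squeeze_cvgr _ _ _ _ (cst 0)
  (fun h => nrm (quot_err f t x h) + nrm (quot_err g t y h))).
- apply: nearW => h; rewrite nrm_ge0/=.
  have -> : quot_err (f + g) t (x + y) h = quot_err f t x h + quot_err g t y h.
    rewrite /quot_err -[(f + g) (t + h)]/(f (t + h) + g (t + h)).
    rewrite -[(f + g) t]/(f t + g t) !opprD addrACA scalerDr.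
    by rewrite addrACA.
  by apply: nrm_leD; exact: sqsumm_quot_err.
- exact: cvg_cst.
- by rewrite -[X in _ --> X]addr0; apply: cvgD.
Qed.

Lemma dl2N f t x : dl2 f t x -> dl2 (- f) t (- x).
Proof.
move=> [sx fx]; split; first exact: sqsummN.
have -> : (fun h => nrm (quot_err (- f) t (- x) h))
  = fun h => nrm (quot_err f t x h) => //.
apply/funext => h; rewrite /nrm.
have -> : quot_err (- f) t (- x) h = - quot_err f t x h.
  rewrite /quot_err -[(- f) (t + h)]/(- f (t + h)) -[(- f) t]/(- f t).
  by rewrite -opprD scalerN -opprD.
by rewrite ipNl ipNr opprK.
Qed.

End L2Derivative.

(** * Conservation law of the chain *)

Lemma addz_bij (k : int) : bijective (fun n : int => n + k).
Proof. by exists (fun n => n - k) => n; rewrite ?addrK ?subrK. Qed.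

Lemma is_derive_lin {R : realType} (f g : R -> R) (a b t df dg : R) :
  is_derive t (1 : R) f df -> is_derive t (1 : R) g dg ->
  is_derive t (1 : R) (fun s => a * f s + b * g s) (a * df + b * dg).
Proof. by move=> hf hg; exact: (is_deriveD (f := a *: f) (g := b *: g)). Qed.

Section Chain.
Context {R : realType}.
Variables eps Omega : R.
Implicit Types x y : int -> R.

Definition shift1 x : int -> R := x \o (fun n => n + 1).

(** The operator L = eps Delta + Omega on real sequences. *)
Definition chain x : int -> R :=
  fun n => eps * (x (n + 1) - 2 * x n + x (n - 1)) + Omega * x n.

Lemma sqsumm_shift x (k : int) : sqsumm x -> sqsumm (fun n => x (n + k)).
Proof. exact/sqsumm_reindex/addz_bij. Qed.

Lemma chainE x : chain x = eps *: (shift1 x + (x \o (fun n => n - 1)))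
  + (Omega - 2 * eps) *: x.
Proof.
apply/funext => n.
have -> : (eps *: (shift1 x + (x \o (fun n => n - 1)))
  + (Omega - 2 * eps) *: x) n
  = eps * (x (n + 1) + x (n - 1)) + (Omega - 2 * eps) * x n by [].
by rewrite /chain; ring.
Qed.

Lemma sqsumm_chain x : sqsumm x -> sqsumm (chain x).
Proof.
move=> sx; rewrite chainE; apply: sqsummD; last exact: sqsummZ.
by apply/sqsummZ/sqsummD; exact: sqsumm_shift.
Qed.

Lemma ip_shiftC x y : ip x (shift1 y) = ip (x \o (fun n => n - 1)) y.
Proof.
have xE : (x \o (fun n => n - 1)) \o (fun n => n + 1) = x.
  by apply/funext => n /=; rewrite addrK.
by rewrite -[X in ip X _]xE; exact: ip_reindex _ _ _ (addz_bij 1).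
Qed.

(** The right-hand side is symmetric in [x] and [y]; self-adjointness of [chain] is used in this
    form. *)
Lemma ip_chain x y : sqsumm x -> sqsumm y ->
  ip x (chain y) = eps * (ip x (shift1 y) + ip (shift1 x) y)
    + (Omega - 2 * eps) * ip x y.
Proof.
move=> sx sy.
have s1 : sqsumm (shift1 y) by exact: sqsumm_shift.
have s2 : sqsumm (y \o (fun n => n - 1)) by exact: sqsumm_shift.
have s3 : sqsumm (shift1 y + (y \o (fun n => n - 1))) by exact: sqsummD.
have s4 : sqsumm (eps *: (shift1 y + (y \o (fun n => n - 1)))) by exact: sqsummZ.
have s5 : sqsumm ((Omega - 2 * eps) *: y) by exact: sqsummZ.
rewrite chainE ipDr// !ipZr// ipDr// (ipC (shift1 x)) (ip_shiftC y x).
by rewrite (ipC _ x).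
Qed.

(** The quadratic form <(L + a) x, x>, expressed through [shift1] so that [is_derive_ip]
    differentiates it directly. *)
Definition chain_form (a : R) x : R :=
  2 * eps * ip x (shift1 x) + (Omega - 2 * eps + a) * ip x x.

(** The shift is an isometry, so [|<x, shift1 x>| <= <x, x>]. This locates the spectrum of L in
    [[Omega - 4 eps, Omega]]. *)
Lemma chain_form_bounds a x : 0 <= eps -> sqsumm x ->
  (Omega - 4 * eps + a) * ip x x <= chain_form a x <= (Omega + a) * ip x x.
Proof.
move=> e0 sx; have sx1 : sqsumm (shift1 x) by exact: sqsumm_shift.
have := normr_ip_le _ _ sx sx1.
have -> : nrm (shift1 x) = nrm x.
  by rewrite /nrm [ip (shift1 x) _]ip_reindex//; exact: addz_bij.
rewrite -expr2 sqr_nrm ler_norml /chain_form.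
move: (ip x (shift1 x)) (ip x x) => p q /andP[pq1 pq2].
by apply/andP; split; nra.
Qed.

(* For [D = u + i v] this is [i D' = chain D - c D^*]. *)
Definition chain_solution (c : R) (u v : R -> int -> R) : Prop :=
  [/\ forall t, sqsumm (u t), forall t, sqsumm (v t),
      forall t, dl2 u t (chain (v t) + c *: v t)
    & forall t, dl2 v t (c *: u t - chain (u t))].

Lemma is_derive_chain_form a (u : R -> int -> R) t x :
  (forall s, sqsumm (u s)) -> dl2 u t x ->
  is_derive t (1 : R) (fun s => chain_form a (u s))
    (2 * ip x (chain (u t) + a *: u t)).
Proof.
move=> su du; have [sx _] := du.
have du1 : dl2 (fun s => shift1 (u s)) t (shift1 x).
  by apply: dl2_reindex => //; exact: addz_bij.
have su1 s : sqsumm (shift1 (u s)) by exact: sqsumm_shift.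
have D1 := is_derive_ip _ _ _ _ _ su su1 du du1.
have D2 := is_derive_ip _ _ _ _ _ su su du du.
have := is_derive_lin _ _ (2 * eps) (Omega - 2 * eps + a) _ _ _ D1 D2.
move/is_derive_eq; apply.
have sc : sqsumm (chain (u t)) by exact: sqsumm_chain.
have sa : sqsumm (a *: u t) by exact: sqsummZ.
rewrite ipDr// ipZr// ip_chain// (ipC (u t) (shift1 x)) (ipC (u t) x).
by ring.
Qed.

(** The derivative is 2 <(L + c) v, (L - c) u> - 2 <(L - c) u, (L + c) v> = 0. *)
Lemma chain_form_conserved c u v t : chain_solution c u v ->
  chain_form (- c) (u t) + chain_form c (v t)
  = chain_form (- c) (u 0) + chain_form c (v 0).
Proof.
move=> [su sv du dv].
pose Q s := chain_form (- c) (u s) + chain_form c (v s).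
suff dQ s : is_derive s (1 : R) Q 0 by exact: (is_derive_0_is_cst t 0 dQ).
have := is_derive_lin _ _ 1 1 _ _ _ (is_derive_chain_form (- c) _ _ _ su (du s))
  (is_derive_chain_form c _ _ _ sv (dv s)).
under eq_fun do rewrite !mul1r.
move/is_derive_eq; apply.
have -> : c *: u s - chain (u s) = - (chain (u s) + - c *: u s).
  by rewrite scaleNr opprB.
by rewrite ipNl (ipC (chain (u s) + _)); ring.
Qed.

(** In the first alternative the conserved form lies between [m] and [M] times the squared norm, in
    the second between [- M] and [- m] times it. Comparing times [t] and 0 gives the bound. *)
Lemma chain_solution_bounded c m M (u v : R -> int -> R) t :
  0 <= eps -> 0 < m ->
  (m <= Omega - 4 * eps - `|c| /\ Omega + `|c| <= M) \/
  (- M <= Omega - 4 * eps - `|c| /\ Omega + `|c| <= - m) ->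
  chain_solution c u v ->
  m * (ip (u t) (u t) + ip (v t) (v t))
  <= M * (ip (u 0) (u 0) + ip (v 0) (v 0)).
Proof.
move=> e0 m0 H sol; have := chain_form_conserved _ _ _ t sol.
move: sol => [su sv _ _].
have /andP[a1 a2] := chain_form_bounds (- c) (u t) e0 (su t).
have /andP[b1 b2] := chain_form_bounds c (v t) e0 (sv t).
have /andP[c1 c2] := chain_form_bounds (- c) (u 0) e0 (su 0).
have /andP[d1 d2] := chain_form_bounds c (v 0) e0 (sv 0).
have pa := ip_ge0 (u t); have pb := ip_ge0 (v t).
have pc := ip_ge0 (u 0); have pd := ip_ge0 (v 0).
have /andP[n1 n2] : - `|c| <= c <= `|c| by rewrite -ler_norml.
move=> E.
move: (ip (u t) (u t)) (ip (v t) (v t)) (ip (u 0) (u 0)) (ip (v 0) (v 0))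
  (chain_form (- c) (u t)) (chain_form c (v t))
  (chain_form (- c) (u 0)) (chain_form c (v 0)) a1 a2 b1 b2 c1 c2 d1 d2
  pa pb pc pd E => p q r s P Q S T *.
move: (`|c|) n1 n2 H => k k1 k2 [[h1 h2]|[h1 h2]].
- have : m * p <= P by nra.
  have : m * q <= Q by nra.
  have : S <= M * r by nra.
  have : T <= M * s by nra.
  by nra.
- have : P <= - m * p by nra.
  have : Q <= - m * q by nra.
  have : - M * r <= S by nra.
  have : - M * s <= T by nra.
  by nra.
Qed.

End Chain.

(** * Real and imaginary parts *)

Section ComplexParts.
Context {R : realType}.
Implicit Types X Y : int -> R[i].

Definition rep X : int -> R := fun n => complex.Re (X n).
Definition imp X : int -> R := fun n => complex.Im (X n).

Lemma sqr_normcE (z : R[i]) :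
  ComplexField.Normc.normc z ^+ 2 = complex.Re z ^+ 2 + complex.Im z ^+ 2.
Proof. by case: z => a b; rewrite /= sqr_sqrtr// addr_ge0 ?sqr_ge0. Qed.

Lemma in_l2P X : in_l2 X <-> sqsumm (rep X) /\ sqsumm (imp X).
Proof.
have -> : in_l2 X = summ (fun n => rep X n ^+ 2 + imp X n ^+ 2).
  rewrite /in_l2 /l2_energy /summ; congr (is_true (_ < _)%E).
  by apply: eq_esum => n _; rewrite sqr_normcE ger0_norm// addr_ge0 ?sqr_ge0.
split=> [s|[s1 s2]]; last exact: summD.
split; apply: summ_le s => n; rewrite !ger0_norm ?addr_ge0 ?sqr_ge0//.
- by rewrite lerDl sqr_ge0.
- by rewrite lerDr sqr_ge0.
Qed.

Lemma sqr_l2norm X : in_l2 X ->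
  l2norm X ^+ 2 = ip (rep X) (rep X) + ip (imp X) (imp X).
Proof.
move=> /in_l2P[s1 s2].
rewrite /ip -sumTD; try exact: summ_mul.
rewrite sumT_ge0E; last by move=> n; rewrite -!expr2 addr_ge0 ?sqr_ge0.
rewrite /l2norm sqr_sqrtr.
  congr fine; apply: eq_esum => n _.
  by rewrite sqr_normcE !expr2.
by apply/fine_ge0/esum_ge0 => n _; rewrite lee_fin sqr_ge0.
Qed.

Lemma l2norm_ge0 X : 0 <= l2norm X. Proof. exact: sqrtr_ge0. Qed.

Lemma nrm_re_le X : in_l2 X -> nrm (rep X) <= l2norm X.
Proof.
move=> X2; rewrite -ler_sqr ?nnegrE ?nrm_ge0 ?l2norm_ge0//.
by rewrite sqr_nrm sqr_l2norm// lerDl ip_ge0.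
Qed.

Lemma nrm_im_le X : in_l2 X -> nrm (imp X) <= l2norm X.
Proof.
move=> X2; rewrite -ler_sqr ?nnegrE ?nrm_ge0 ?l2norm_ge0//.
by rewrite sqr_nrm sqr_l2norm// lerDr ip_ge0.
Qed.

Lemma l2norm_le X : in_l2 X -> l2norm X <= nrm (rep X) + nrm (imp X).
Proof.
move=> X2.
rewrite -ler_sqr ?nnegrE ?l2norm_ge0 ?addr_ge0 ?nrm_ge0//.
rewrite sqr_l2norm// sqrrD !sqr_nrm lerD2r lerDl.
by rewrite mulrn_wge0// mulr_ge0 ?nrm_ge0.
Qed.

Definition quotC (A : R -> int -> R[i]) t dA (h : R) : int -> R[i] :=
  fun n => real_complex R h^-1 * (A (t + h) n - A t n) - dA n.

Lemma rep_quotC A t dA h :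
  rep (quotC A t dA h) = quot_err (rep \o A) t (rep dA) h.
Proof.
apply/funext => n; rewrite /rep /quotC /quot_err /=.
have -> : (h^-1 *: (rep (A (t + h)) - rep (A t)) - rep dA) n
  = h^-1 * (complex.Re (A (t + h) n) - complex.Re (A t n))
    - complex.Re (dA n) by [].
by case: (A (t + h) n) (A t n) (dA n) => [a b] [c d] [e f] /=; ring.
Qed.

Lemma imp_quotC A t dA h :
  imp (quotC A t dA h) = quot_err (imp \o A) t (imp dA) h.
Proof.
apply/funext => n; rewrite /imp /quotC /quot_err /=.
have -> : (h^-1 *: (imp (A (t + h)) - imp (A t)) - imp dA) n
  = h^-1 * (complex.Im (A (t + h) n) - complex.Im (A t n))
    - complex.Im (dA n) by [].
by case: (A (t + h) n) (A t n) (dA n) => [a b] [c d] [e f] /=; ring.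
Qed.

(** [l2norm] dominates the norms of both parts and is at most their sum, so each limit squeezes the
    other. *)
Lemma is_l2_deriveP A t dA : (forall s, in_l2 (A s)) ->
  is_l2_derive A t dA <-> dl2 (rep \o A) t (rep dA) /\ dl2 (imp \o A) t (imp dA).
Proof.
move=> sA.
have sre s : sqsumm ((rep \o A) s) by case/in_l2P: (sA s).
have sim s : sqsumm ((imp \o A) s) by case/in_l2P: (sA s).
have sq : in_l2 dA -> forall h, in_l2 (quotC A t dA h).
  move=> /in_l2P[d1 d2] h; apply/in_l2P; rewrite rep_quotC imp_quotC.
  by split; exact: sqsumm_quot_err.
split=> [[dA2 lim]|[[s1 l1] [s2 l2]]].
- have [d1 d2] := (in_l2P dA).1 dA2.
  split; split=> //.
  + apply: (@squeeze_cvgr _ _ _ _ (cst 0)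
      (fun h => l2norm (quotC A t dA h))) lim.
    * by apply: nearW => h; rewrite nrm_ge0 -rep_quotC nrm_re_le//; exact: sq.
    * exact: cvg_cst.
  + apply: (@squeeze_cvgr _ _ _ _ (cst 0)
      (fun h => l2norm (quotC A t dA h))) lim.
    * by apply: nearW => h; rewrite nrm_ge0 -imp_quotC nrm_im_le//; exact: sq.
    * exact: cvg_cst.
- have dA2 : in_l2 dA by exact/in_l2P.
  split=> //.
  apply: (@squeeze_cvgr _ _ _ _ (cst 0)
    (fun h => nrm (quot_err (rep \o A) t (rep dA) h)
              + nrm (quot_err (imp \o A) t (imp dA) h))).
  + apply: nearW => h; rewrite l2norm_ge0 -rep_quotC -imp_quotC/=.
    by apply: l2norm_le; exact: sq.
  + exact: cvg_cst.
  + by rewrite -[X in _ --> X]addr0; exact: cvgD.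
Qed.

End ComplexParts.

(** * Decoupling and stability *)

Lemma ip_parallelogram {R : realType} {T : choiceType} (x y : T -> R) :
  sqsumm x -> sqsumm y ->
  ip (x - y) (x - y) + ip (x + y) (x + y) = 2 * (ip x x + ip y y).
Proof.
move=> sx sy; have sxy : sqsumm (x + y) by exact: sqsummD.
have sNy : sqsumm (- y) by exact: sqsummN.
have sxNy : sqsumm (x - y) by exact: sqsummB.
by rewrite !ipDl// !ipDr// !ipNl !ipNr (ipC y x); ring.
Qed.

Section Reduction.
Context {R : realType}.
Variables eps Omega gamma : R.
Implicit Types X Y : int -> R[i].

(** Multiplication by i exchanges the two parts with one sign change. The conjugates in the coupling
    undo that sign for [gamma], while [chain] keeps it. *)
Lemma linearized_rhsP X Y (z : R[i]) n :
  Complex 0 1 * z = linearized_rhs eps Omega gamma X Y n <->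
  complex.Re z = chain eps Omega (imp X) n + gamma * (imp X n - imp Y n) /\
  complex.Im z = - chain eps Omega (rep X) n + gamma * (rep X n - rep Y n).
Proof.
rewrite /linearized_rhs /chain /rep /imp.
case: z (X (n + 1)) (X n) (X (n - 1)) (Y n)
  => [z1 z2] [a1 a2] [b1 b2] [c1 c2] [d1 d2].
split=> /=.
- move=> /eqP; rewrite eq_complex /= => /andP[/eqP h1 /eqP h2].
  by split; lra.
- move=> [-> ->]; apply/eqP; rewrite eq_complex /=.
  by apply/andP; split; apply/eqP; ring.
Qed.

(** The coupling terms of the two equations are opposite: they double in the difference, hence
    [2 * gamma], and cancel in the sum. *)
Lemma linearized_chain_sub A B :
  l2_solution (linearized_rhs eps Omega gamma) A B ->
  chain_solution eps Omega (2 * gamma)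
    (fun t => rep (A t) - rep (B t)) (fun t => imp (A t) - imp (B t)).
Proof.
move=> [sAB [dA [dB sol]]].
have sA t : in_l2 (A t) by case: (sAB t).
have sB t : in_l2 (B t) by case: (sAB t).
have rA t : sqsumm (rep (A t)) by have [] := (in_l2P _).1 (sA t).
have iA t : sqsumm (imp (A t)) by have [] := (in_l2P _).1 (sA t).
have rB t : sqsumm (rep (B t)) by have [] := (in_l2P _).1 (sB t).
have iB t : sqsumm (imp (B t)) by have [] := (in_l2P _).1 (sB t).
split=> t; try exact: sqsummB.
- have [/is_l2_deriveP[//|dA1 dA2] /is_l2_deriveP[//|dB1 dB2] eA eB] := sol t.
  have := dl2D _ _ _ _ _ rA _ dA1 (dl2N _ _ _ dB1).
  have -> : rep (dA t) - rep (dB t) =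
      chain eps Omega (imp (A t) - imp (B t))
      + (2 * gamma) *: (imp (A t) - imp (B t)).
    apply/funext => n.
    have /linearized_rhsP[e1 _] := eA n; have /linearized_rhsP[e2 _] := eB n.
    have -> : (rep (dA t) - rep (dB t)) n
      = complex.Re (dA t n) - complex.Re (dB t n) by [].
    rewrite e1 e2 -[RHS]/(chain eps Omega (fun n => imp (A t) n - imp (B t) n) n
      + 2 * gamma * (imp (A t) n - imp (B t) n)) /chain.
    by ring.
  by apply=> s; exact: (sqsummN _ (rB s)).
- have [/is_l2_deriveP[//|dA1 dA2] /is_l2_deriveP[//|dB1 dB2] eA eB] := sol t.
  have := dl2D _ _ _ _ _ iA _ dA2 (dl2N _ _ _ dB2).
  have -> : imp (dA t) - imp (dB t) =
      (2 * gamma) *: (rep (A t) - rep (B t))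
      - chain eps Omega (rep (A t) - rep (B t)).
    apply/funext => n.
    have /linearized_rhsP[_ e1] := eA n; have /linearized_rhsP[_ e2] := eB n.
    have -> : (imp (dA t) - imp (dB t)) n
      = complex.Im (dA t n) - complex.Im (dB t n) by [].
    rewrite e1 e2 -[RHS]/(2 * gamma * (rep (A t) n - rep (B t) n)
      - chain eps Omega (fun n => rep (A t) n - rep (B t) n) n) /chain.
    by ring.
  by apply=> s; exact: (sqsummN _ (iB s)).
Qed.

Lemma linearized_chain_add A B :
  l2_solution (linearized_rhs eps Omega gamma) A B ->
  chain_solution eps Omega 0
    (fun t => rep (A t) + rep (B t)) (fun t => imp (A t) + imp (B t)).
Proof.
move=> [sAB [dA [dB sol]]].
have sA t : in_l2 (A t) by case: (sAB t).
have sB t : in_l2 (B t) by case: (sAB t).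
have rA t : sqsumm (rep (A t)) by have [] := (in_l2P _).1 (sA t).
have iA t : sqsumm (imp (A t)) by have [] := (in_l2P _).1 (sA t).
have rB t : sqsumm (rep (B t)) by have [] := (in_l2P _).1 (sB t).
have iB t : sqsumm (imp (B t)) by have [] := (in_l2P _).1 (sB t).
split=> t; try exact: sqsummD.
- have [/is_l2_deriveP[//|dA1 dA2] /is_l2_deriveP[//|dB1 dB2] eA eB] := sol t.
  have := dl2D _ _ _ _ _ rA rB dA1 dB1.
  have -> // : rep (dA t) + rep (dB t) =
      chain eps Omega (imp (A t) + imp (B t)) + 0 *: (imp (A t) + imp (B t)).
  apply/funext => n.
  have /linearized_rhsP[e1 _] := eA n; have /linearized_rhsP[e2 _] := eB n.
  have -> : (rep (dA t) + rep (dB t)) n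
    = complex.Re (dA t n) + complex.Re (dB t n) by [].
  rewrite e1 e2 -[RHS]/(chain eps Omega (fun n => imp (A t) n + imp (B t) n) n
    + 0 * (imp (A t) n + imp (B t) n)) /chain.
  by ring.
- have [/is_l2_deriveP[//|dA1 dA2] /is_l2_deriveP[//|dB1 dB2] eA eB] := sol t.
  have := dl2D _ _ _ _ _ iA iB dA2 dB2.
  have -> // : imp (dA t) + imp (dB t) =
      0 *: (rep (A t) + rep (B t)) - chain eps Omega (rep (A t) + rep (B t)).
  apply/funext => n.
  have /linearized_rhsP[_ e1] := eA n; have /linearized_rhsP[_ e2] := eB n.
  have -> : (imp (dA t) + imp (dB t)) n
    = complex.Im (dA t n) + complex.Im (dB t n) by [].
  rewrite e1 e2 -[RHS]/(0 * (rep (A t) n + rep (B t) n)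
    - chain eps Omega (fun n => rep (A t) n + rep (B t) n) n) /chain.
  by ring.
Qed.

Lemma linearly_stable (m M : R) : 0 <= eps -> 0 < m ->
  (m <= Omega - 4 * eps - 2 * `|gamma| /\ Omega + 2 * `|gamma| <= M) \/
  (- M <= Omega - 4 * eps - 2 * `|gamma| /\ Omega + 2 * `|gamma| <= - m) ->
  zero_linearly_stable eps Omega gamma.
Proof.
(* The ratio [M / m] comes from the bounds on difference and sum, and the factor 2 from
   [(a + b)^2 <= 2 (a^2 + b^2)]. *)
move=> e0 m0 H; exists (Num.sqrt (2 * (M / m))) => A B sol t.
have M0 : 0 <= M by have := normr_ge0 gamma; move: H => [[]|[]]; lra.
have s1 := linearized_chain_sub _ _ sol; have s2 := linearized_chain_add _ _ sol.
have b1 : m * (ip (rep (A t) - rep (B t)) (rep (A t) - rep (B t))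
    + ip (imp (A t) - imp (B t)) (imp (A t) - imp (B t)))
  <= M * (ip (rep (A 0) - rep (B 0)) (rep (A 0) - rep (B 0))
    + ip (imp (A 0) - imp (B 0)) (imp (A 0) - imp (B 0))).
  apply: (chain_solution_bounded eps Omega (2 * gamma) m M _ _ t e0 m0 _ s1).
  by rewrite normrM ger0_norm.
have b2 : m * (ip (rep (A t) + rep (B t)) (rep (A t) + rep (B t))
    + ip (imp (A t) + imp (B t)) (imp (A t) + imp (B t)))
  <= M * (ip (rep (A 0) + rep (B 0)) (rep (A 0) + rep (B 0))
    + ip (imp (A 0) + imp (B 0)) (imp (A 0) + imp (B 0))).
  (* The bounds assumed for c = 2 gamma imply those for c = 0, so the same [m] and [M] serve the
     sum. *)
  apply: (chain_solution_bounded eps Omega 0 m M _ _ t e0 m0 _ s2).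
  rewrite normr0; have := normr_ge0 gamma.
  by move: H => [[? ?]|[? ?]]; [left|right]; lra.
have par s : ip (rep (A s) - rep (B s)) (rep (A s) - rep (B s))
    + ip (imp (A s) - imp (B s)) (imp (A s) - imp (B s))
    + (ip (rep (A s) + rep (B s)) (rep (A s) + rep (B s))
    + ip (imp (A s) + imp (B s)) (imp (A s) + imp (B s)))
  = 2 * (l2norm (A s) ^+ 2 + l2norm (B s) ^+ 2).
  have [sA sB] := sol.1 s.
  have [rA iA] := (in_l2P _).1 sA; have [rB iB] := (in_l2P _).1 sB.
  have p1 := ip_parallelogram _ _ rA rB; have p2 := ip_parallelogram _ _ iA iB.
  rewrite (sqr_l2norm _ sA) (sqr_l2norm _ sB).
  (* Pairs real parts with real parts and imaginary with imaginary, one parallelogram identity for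
     each pair. *)
  rewrite [LHS](AC (2*2) ((1*3)*(2*4))).
  transitivity (2 * (ip (rep (A s)) (rep (A s)) + ip (rep (B s)) (rep (B s)))
    + 2 * (ip (imp (A s)) (imp (A s)) + ip (imp (B s)) (imp (B s)))).
    by congr (_ + _). 
  by ring.
have := lerD b1 b2; rewrite -!mulrDr !par.
have := l2norm_ge0 (A t); have := l2norm_ge0 (B t).
have := l2norm_ge0 (A 0); have := l2norm_ge0 (B 0).
move: (l2norm (A t)) (l2norm (B t)) (l2norm (A 0)) (l2norm (B 0)) => a b p q.
move=> q0 p0 b0 a0 ineq.
have K0 : 0 <= 2 * (M / m) by rewrite mulr_ge0// divr_ge0// ltW.
rewrite -ler_sqr ?nnegrE ?addr_ge0 ?mulr_ge0 ?sqrtr_ge0 ?addr_ge0//.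
rewrite exprMn sqr_sqrtr//.
have -> : 2 * (M / m) * (p + q) ^+ 2 = (2 * M * (p + q) ^+ 2) / m.
  by field; rewrite gt_eqF.
rewrite ler_pdivlMr//.
have h1 : (a + b) ^+ 2 <= 2 * (a ^+ 2 + b ^+ 2).
  by have := sqr_ge0 (a - b); nra.
have h2 : p ^+ 2 + q ^+ 2 <= (p + q) ^+ 2 by nra.
have := ler_wpM2l (ltW m0) h1; have := ler_wpM2l M0 h2; lra.
Qed.

(** For [B = - A] the coupling becomes -2 gamma times the conjugate of A, and both equations reduce
    to the single chain with c = 2 gamma. This carries growth on the chain back to the system. *)
Lemma chain_linearized (u v : R -> int -> R)
    (A := fun t n => Complex (u t n) (v t n)) :
  chain_solution eps Omega (2 * gamma) u v ->
  l2_solution (linearized_rhs eps Omega gamma) A (- A).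
Proof.
move=> [su sv du dv].
have sA t : in_l2 (A t) by apply/in_l2P; split; [exact: su|exact: sv].
have sB t : in_l2 ((- A) t).
  by apply/in_l2P; split; [exact/sqsummN/su|exact/sqsummN/sv].
split=> //.
pose x t := chain eps Omega (v t) + (2 * gamma) *: v t.
pose y t := (2 * gamma) *: u t - chain eps Omega (u t).
exists (fun t n => Complex (x t n) (y t n)),
  (fun t n => - Complex (x t n) (y t n)).
move=> t; split.
- by apply/is_l2_deriveP.
- apply/is_l2_deriveP => //; split.
  + exact: dl2N (du t).
  + exact: dl2N (dv t).
- move=> n; apply/linearized_rhsP => /=; rewrite /x /y.
  split.
  + rewrite -[LHS]/(chain eps Omega (v t) n + 2 * gamma * v t n).
    rewrite -[imp (A t)]/(v t) -[imp ((- A) t)]/(- v t) -[(- v t) n]/(- v t n).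
    by ring.
  + rewrite -[LHS]/(2 * gamma * u t n - chain eps Omega (u t) n).
    rewrite -[rep (A t)]/(u t) -[rep ((- A) t)]/(- u t) -[(- u t) n]/(- u t n).
    by ring.
- move=> n; apply/linearized_rhsP => /=; rewrite /x /y.
  split.
  + rewrite -[LHS]/(- (chain eps Omega (v t) n + 2 * gamma * v t n)).
    rewrite -[imp (A t)]/(v t) -[imp ((- A) t)]/(fun n => - v t n) /chain.
    by ring.
  + rewrite -[LHS]/(- (2 * gamma * u t n - chain eps Omega (u t) n)).
    rewrite -[rep (A t)]/(u t) -[rep ((- A) t)]/(fun n => - u t n) /chain.
    by ring.
Qed.

End Reduction.

(** * Existence of solutions with exponentially decaying data *)

Section ExpSeries.
Context {R : realType}.
Implicit Types x : nat -> R.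

(** The exponential generating function of [x]; differentiating it in [t] shifts the sequence by one
    index. *)
Definition exp_series x (t : R) : R :=
  limn (pseries (fun k => x k / k`!%:R) t).

Lemma normed_pseries_le x (B C t : R) : (forall k, `|x k| <= B * C ^+ k) ->
  cvgn [normed pseries (fun k => x k / k`!%:R) t] /\
  limn [normed pseries (fun k => x k / k`!%:R) t] <= B * expR (C * `|t|).
Proof.
move=> xB.
have cv : cvgn (series (B *: exp_coeff (C * `|t|))).
  exact/is_cvg_seriesZ/is_cvg_series_exp_coeff.
have le k : `|x k / k`!%:R * t ^+ k| <= (B *: exp_coeff (C * `|t|)) k.
  rewrite -[leRHS]/(B * ((C * `|t|) ^+ k / k`!%:R)) exprMn.
  rewrite !normrM normfV normrX (ger0_norm (ler0n _ _)).
  have -> : `|x k| / k`!%:R * `|t| ^+ k = `|x k| * (`|t| ^+ k / k`!%:R) by ring.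
  have -> : B * (C ^+ k * `|t| ^+ k / k`!%:R)
      = B * C ^+ k * (`|t| ^+ k / k`!%:R).
    by ring.
  by rewrite ler_wpM2r// divr_ge0 ?exprn_ge0.
have cvn : cvgn [normed pseries (fun k => x k / k`!%:R) t].
  apply: series_le_cvg (le) (cv) => // k.
  exact: le_trans (normr_ge0 _) (le k).
split=> //.
have -> : B * expR (C * `|t|) = limn (series (B *: exp_coeff (C * `|t|))).
  by rewrite lim_seriesZ//; exact: is_cvg_series_exp_coeff.
exact: lim_series_le.
Qed.

Lemma is_cvg_exp_series x (B C t : R) : (forall k, `|x k| <= B * C ^+ k) ->
  cvgn (pseries (fun k => x k / k`!%:R) t).
Proof. by move=> /normed_pseries_le -/(_ t)[] cv _; exact: normed_cvg. Qed.

Lemma norm_exp_series_le x (B C t : R) : (forall k, `|x k| <= B * C ^+ k) ->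
  `|exp_series x t| <= B * expR (C * `|t|).
Proof.
move=> /normed_pseries_le -/(_ t)[cv]; apply: le_trans.
exact: lim_series_norm.
Qed.

(** Three summands, because [chain] combines a site with its two neighbours. *)
Lemma exp_series_lin3 x y z (a b d B C B' C' B'' C'' t : R) :
  (forall k, `|x k| <= B * C ^+ k) -> (forall k, `|y k| <= B' * C' ^+ k) ->
  (forall k, `|z k| <= B'' * C'' ^+ k) ->
  exp_series (fun k => a * x k + b * y k + d * z k) t
  = a * exp_series x t + b * exp_series y t + d * exp_series z t.
Proof.
move=> /is_cvg_exp_series -/(_ t) cx /is_cvg_exp_series -/(_ t) cy.
move=> /is_cvg_exp_series -/(_ t) cz.
rewrite /exp_series -[a * _](lim_seriesZ a cx) -[b * _](lim_seriesZ b cy).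
rewrite -[d * _](lim_seriesZ d cz).
rewrite -lim_seriesD; try exact: is_cvg_seriesZ.
rewrite -lim_seriesD; last 2 first.
- by apply: is_cvg_seriesD; exact: is_cvg_seriesZ.
- exact: is_cvg_seriesZ.
congr (limn (series _)); apply/funext => k /=.
rewrite -[RHS]/(a * (x k / k`!%:R * t ^+ k) + b * (y k / k`!%:R * t ^+ k)
  + d * (z k / k`!%:R * t ^+ k)).
by ring.
Qed.

Lemma exp_series0 x : exp_series x 0 = x 0%N.
Proof.
apply: lim_near_cst => //; near=> m; rewrite -[m]prednK; last by near: m.
rewrite /pseries /series /= big_nat_recl// big1 ?addr0.
  by rewrite expr0 mulr1 fact0 divr1.
by move=> i _; rewrite expr0n mulr0.
Unshelve. all: by end_near. Qed.

Lemma is_derive_exp_series x (B C t : R) : 0 <= C ->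
  (forall k, `|x k| <= B * C ^+ k) ->
  is_derive t (1 : R) (exp_series x) (exp_series (fun k => x k.+1) t).
Proof.
move=> C0 xB.
have dE (y : nat -> R) : pseries_diffs (fun k => y k / k`!%:R)
    = fun k => y k.+1 / k`!%:R.
  apply/funext => k; rewrite /pseries_diffs factS natrM.
  by field; rewrite pnatr_eq0 -lt0n fact_gt0 gt_eqF// ltr_pwDl.
(* Termwise differentiation at [t] uses convergence of the series and of its first two formal
   derivatives at the larger radius [|t| + 1]. Shifting the sequence only multiplies [B] by powers
   of [C]. *)
have xB1 k : `|x k.+1| <= (B * C) * C ^+ k.
  by rewrite -mulrA -exprS.
have xB2 k : `|x k.+2| <= (B * C * C) * C ^+ k.
  by rewrite -mulrA -exprS.
have := @pseries_snd_diffs R (fun k => x k / k`!%:R) (`|t| + 1) t.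
rewrite dE (dE (fun k => x k.+1)); apply.
- exact: is_cvg_exp_series xB.
- exact: is_cvg_exp_series xB1.
- exact: is_cvg_exp_series xB2.
- by rewrite [ltRHS]ger0_norm ?addr_ge0// ltrDl.
Qed.

(** A mean value theorem with no order between [a] and [b]: the error estimates for increments of
    either sign only use the distance from the intermediate point to [a]. *)
Lemma mvt_norm (f df : R -> R) (a b : R) :
  (forall s, is_derive s (1 : R) f (df s)) ->
  exists2 c, `|c - a| <= `|b - a| & f b - f a = df c * (b - a).
Proof.
move=> Df.
have cf (p q : R) : {within `[p, q], continuous f}.
  apply: continuous_subspaceT => s.
  by apply: differentiable_continuous; apply/derivable1_diffP; have [] := Df s.
have [ab|/ltW ba] := leP a b.
- have [c] := MVT_segment ab (fun s _ => Df s) (cf a b).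
  rewrite in_itv/= => /andP[h1 h2] E; exists c => //.
  by rewrite !ger0_norm ?subr_ge0// lerD2r.
- have [c] := MVT_segment ba (fun s _ => Df s) (cf b a).
  rewrite in_itv/= => /andP[h1 h2] E; exists c => //.
    by rewrite !ler0_norm ?subr_le0// lerN2 lerD2r.
  by rewrite -[LHS]opprB E -mulrN opprB.
Qed.

(** The mean value theorem twice: the quotient is [f1 c] with [|c - t| <= |h|], and [f1 c - f1 t] is
    [f2 d * (c - t)], where [|d| <= |t| + 1]. *)
Lemma quotient_error_le (f f1 f2 : R -> R) (t h M : R) :
  (forall s, is_derive s (1 : R) f (f1 s)) ->
  (forall s, is_derive s (1 : R) f1 (f2 s)) ->
  (forall s, `|s| <= `|t| + 1 -> `|f2 s| <= M) -> h != 0 -> `|h| <= 1 ->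
  `|h^-1 * (f (t + h) - f t) - f1 t| <= M * `|h|.
Proof.
move=> D1 D2 fM h0 h1.
have [c cle ->] := mvt_norm f f1 t (t + h) D1.
have [d dle] := mvt_norm f1 f2 t c D2.
rewrite addrAC subrr add0r in cle *.
rewrite [f1 c * h]mulrC mulKf// => ->.
rewrite normrM ler_pM//; apply: fM.
rewrite -[d](subrK t) (le_trans (ler_normD _ _))// addrC lerD2l.
exact: le_trans dle (le_trans cle h1).
Qed.

End ExpSeries.

(** The quotient error at site [n] is at most [|h| * |M| * w n]; since [w] is square summable, the
    error tends to 0 in norm and not only at each site. *)
Lemma dl2_componentwise {R : realType} {T : choiceType} (w : T -> R)
    (f f1 f2 : R -> T -> R) (t M : R) :
  (forall n s, is_derive s (1 : R) (f^~ n) (f1 s n)) ->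
  (forall n s, is_derive s (1 : R) (f1^~ n) (f2 s n)) ->
  (forall n s, `|s| <= `|t| + 1 -> `|f2 s n| <= M * w n) ->
  sqsumm w -> sqsumm (f1 t) -> dl2 f t (f1 t).
Proof.
move=> D1 D2 fM sw s1; split=> //.
apply: (@squeeze_cvgr _ _ _ _ (cst 0) (fun h => `|h| * (`|M| * nrm w))).
- near=> h; rewrite nrm_ge0/=.
  have h0 : h != 0 by near: h; exact: nbhs_dnbhs_neq.
  have h1 : `|h| <= 1 by near: h; apply: dnbhs0_le.
  have -> : `|h| * (`|M| * nrm w) = nrm ((h * M) *: w).
    by rewrite nrmZ// normrM mulrA.
  apply: ler_nrm; last exact: sqsummZ.
  move=> n.
  rewrite -[quot_err _ _ _ _ n]/(h^-1 * (f (t + h) n - f t n) - f1 t n).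
  apply: le_trans (quotient_error_le _ _ _ t h (M * w n)
    (D1 n) (D2 n) (fM n) h0 h1) _.
  rewrite -[((h * M) *: w) n]/(h * M * w n) -(mulrA h) normrM [leLHS]mulrC.
  by rewrite ler_wpM2l// ler_norm.
- exact: cvg_cst.
- rewrite -[X in _ --> X](mul0r (`|M| * nrm w)); apply: cvgMr_tmp.
  by apply/norm_cvg0P; exact: cvg_within.
Unshelve. all: by end_near. Qed.

(** * The chain flow as a power series in time *)

Section ChainFlow.
Context {R : realType}.
Variables (eps Omega c rho : R) (w : int -> R).
Hypothesis rho0 : 0 <= rho.
Hypothesis w0 : forall n, 0 <= w n.
Hypothesis w_succ : forall n, w (n + 1) <= rho * w n.
Hypothesis w_pred : forall n, w (n - 1) <= rho * w n.
Hypothesis sw : sqsumm w.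
Variables x0 y0 : int -> R.
Hypothesis x0w : forall n, `|x0 n| <= w n.
Hypothesis y0w : forall n, `|y0 n| <= w n.

(** The generator of the flow; its [k]-th iterate on the data is the [k]-th time derivative at 0. *)
Let step (z : (int -> R) * (int -> R)) : (int -> R) * (int -> R) :=
  (fun n => chain eps Omega z.2 n + c * z.2 n,
   fun n => c * z.1 n - chain eps Omega z.1 n).

(** Bounds [step] in the sup norm weighted by [w]: each neighbour costs a factor [rho], the central
    term of the Laplacian a factor 2. *)
Let C : R := `|eps| * (2 * rho + 2) + `|Omega| + `|c|.

Let C0 : 0 <= C.
Proof. by rewrite !addr_ge0 ?mulr_ge0// addr_ge0// mulr_ge0. Qed.

Let chain_le (x : int -> R) D : 0 <= D -> (forall n, `|x n| <= D * w n) ->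
  forall n, `|chain eps Omega x n| <= (C - `|c|) * (D * w n).
Proof.
move=> D0 xD n; rewrite /chain /C addrK [leRHS]mulrDl.
apply: le_trans (ler_normD _ _) _; rewrite !normrM lerD ?ler_wpM2l//.
rewrite -mulrA ler_wpM2l//.
have := ler_normD (x (n + 1) - 2 * x n) (x (n - 1)).
have := ler_normB (x (n + 1)) (2 * x n); rewrite normrM (ger0_norm (ler0n _ 2)).
have := xD n; have := xD (n + 1); have := xD (n - 1).
have := ler_wpM2l D0 (w_succ n); have := ler_wpM2l D0 (w_pred n).
lra.
Qed.

Let iter_le k n : `|(iter k step (x0, y0)).1 n| <= w n * C ^+ k /\
                  `|(iter k step (x0, y0)).2 n| <= w n * C ^+ k.
Proof.
elim: k n => [|k IH] n; first by rewrite !expr0 !mulr1.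
have Ck : 0 <= C ^+ k by exact: exprn_ge0.
have IH1 m : `|(iter k step (x0, y0)).1 m| <= C ^+ k * w m.
  by rewrite mulrC; have [] := IH m.
have IH2 m : `|(iter k step (x0, y0)).2 m| <= C ^+ k * w m.
  by rewrite mulrC; have [] := IH m.
have := chain_le _ _ Ck IH1 n; have := chain_le _ _ Ck IH2 n.
have := ler_wpM2l (normr_ge0 c) (IH1 n); have := ler_wpM2l (normr_ge0 c) (IH2 n).
rewrite -!normrM iterS /= exprS; move: (iter k step (x0, y0)) => z h1 h2 h3 h4.
split.
- by apply: le_trans (ler_normD _ _) _; lra.
- by apply: le_trans (ler_normB _ _) _; lra.
Qed.

Let X k n := (iter k step (x0, y0)).1 n.
Let Y k n := (iter k step (x0, y0)).2 n.

(** Written as a constant times [C ^+ k], the form in which [exp_series] takes bounds on the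
    sequence shifted by [j]. *)
Let XB j n k : `|X (j + k) n| <= w n * C ^+ j * C ^+ k.
Proof. by rewrite -mulrA -exprD; have [] := iter_le (j + k) n. Qed.

Let YB j n k : `|Y (j + k) n| <= w n * C ^+ j * C ^+ k.
Proof. by rewrite -mulrA -exprD; have [] := iter_le (j + k) n. Qed.

(* [U j] and [V j] turn out to be the [j]-th time derivatives of the solution. *)
Let U j (t : R) : int -> R := fun n => exp_series (fun k => X (j + k) n) t.
Let V j (t : R) : int -> R := fun n => exp_series (fun k => Y (j + k) n) t.

Let U_succ j t : U j.+1 t = chain eps Omega (V j t) + c *: V j t.
Proof.
apply/funext => n.
rewrite -[RHS]/(chain eps Omega (V j t) n + c * V j t n) /chain.
transitivity (eps * V j t (n + 1) + (Omega + c - 2 * eps) * V j t n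
  + eps * V j t (n - 1)); last by ring.
rewrite -(exp_series_lin3 _ _ _ _ _ _ _ _ _ _ _ _ _ (YB j (n + 1)) (YB j n)
  (YB j (n - 1))).
congr (exp_series _ t); apply/funext => k.
rewrite -[LHS]/(chain eps Omega (Y (j + k)) n + c * Y (j + k) n) /chain.
by ring.
Qed.

Let V_succ j t : V j.+1 t = c *: U j t - chain eps Omega (U j t).
Proof.
apply/funext => n.
rewrite -[RHS]/(c * U j t n - chain eps Omega (U j t) n) /chain.
transitivity (- eps * U j t (n + 1) + (c - Omega + 2 * eps) * U j t n
  + - eps * U j t (n - 1)); last by ring.
rewrite -(exp_series_lin3 _ _ _ _ _ _ _ _ _ _ _ _ _ (XB j (n + 1)) (XB j n)
  (XB j (n - 1))).
congr (exp_series _ t); apply/funext => k.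
rewrite -[LHS]/(c * X (j + k) n - chain eps Omega (X (j + k)) n) /chain.
by ring.
Qed.

Let U_derive j n s : is_derive s (1 : R) (fun s => U j s n) (U j.+1 s n).
Proof.
have := is_derive_exp_series _ _ _ s C0 (XB j n).
have -> // : (fun k => X (j + k.+1)%N n) = fun k => X (j.+1 + k)%N n.
by apply/funext => k; rewrite addnS.
Qed.

Let V_derive j n s : is_derive s (1 : R) (fun s => V j s n) (V j.+1 s n).
Proof.
have := is_derive_exp_series _ _ _ s C0 (YB j n).
have -> // : (fun k => Y (j + k.+1)%N n) = fun k => Y (j.+1 + k)%N n.
by apply/funext => k; rewrite addnS.
Qed.

(** Uniform on [|s| <= |t| + 1], the window in which [dl2_componentwise] asks for a majorant. *)
Let growth j (t : R) : R := C ^+ j * expR (C * (`|t| + 1)).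

Let U_le j t n s : `|s| <= `|t| + 1 -> `|U j s n| <= growth j t * w n.
Proof.
move=> st; apply: le_trans (norm_exp_series_le _ _ _ s (XB j n)) _.
rewrite -mulrA mulrC ler_wpM2r// ler_wpM2l ?exprn_ge0// ler_expR.
exact: ler_wpM2l.
Qed.

Let V_le j t n s : `|s| <= `|t| + 1 -> `|V j s n| <= growth j t * w n.
Proof.
move=> st; apply: le_trans (norm_exp_series_le _ _ _ s (YB j n)) _.
rewrite -mulrA mulrC ler_wpM2r// ler_wpM2l ?exprn_ge0// ler_expR.
exact: ler_wpM2l.
Qed.

Let sqsumm_U j t : sqsumm (U j t).
Proof.
apply: sqsumm_le (sqsummZ (growth j t) _ sw) => n.
apply: le_trans (U_le j t n t _) _; first by rewrite lerDl.
exact: ler_norm.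
Qed.

Let sqsumm_V j t : sqsumm (V j t).
Proof.
apply: sqsumm_le (sqsummZ (growth j t) _ sw) => n.
apply: le_trans (V_le j t n t _) _; first by rewrite lerDl.
exact: ler_norm.
Qed.

Lemma chain_solution_exists :
  exists u v : R -> int -> R,
    [/\ chain_solution eps Omega c u v, u 0 = x0 & v 0 = y0].
Proof.
exists (U 0), (V 0); split.
- split=> // t; [rewrite -U_succ|rewrite -V_succ].
  + exact: (dl2_componentwise _ _ _ _ t _ (U_derive 0) (U_derive 1)
      (U_le 2 t) sw).
  + exact: (dl2_componentwise _ _ _ _ t _ (V_derive 0) (V_derive 1)
      (V_le 2 t) sw).
- by apply/funext => n; exact: exp_series0.
- by apply/funext => n; exact: exp_series0.
Qed.

End ChainFlow.

(** * Approximate eigenvectors *)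

Section ApproximateEigenvector.
Context {R : realType}.

Definition weight (r : R) : int -> R := fun n => r ^+ absz n.

Lemma esum_geometric_lty (q : R) : 0 < q < 1 ->
  (\esum_(i in [set: nat]) (q ^+ i)%:E < +oo)%E.
Proof.
move=> /andP[q0 q1]; rewrite -nneseries_esumT; last first.
  by move=> n; rewrite lee_fin exprn_ge0// ltW.
apply: le_lt_trans (ltry (1 / (1 - q))); apply: lime_le.
  by apply: is_cvg_nneseries => n _ _; rewrite lee_fin exprn_ge0// ltW.
apply: nearW => n; rewrite sumEFin lee_fin.
have := geometric_le_lim n ler01 q0; rewrite gtr0_norm// => /(_ q1).
by rewrite -exprn_geometric.
Qed.

(** The integers split into the images of [Posz] and [Negz], and each half is dominated by the
    geometric series of ratio [r ^+ 2]. *)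
Lemma sqsumm_weight (r : R) : 0 < r < 1 -> sqsumm (weight r).
Proof.
move=> /andP[r0 r1]; have q01 : 0 < r ^+ 2 < 1.
  by rewrite exprn_gt0//= exprn_ilt1// ltW.
have fE n : (`|weight r n ^+ 2|%:E = ((r ^+ 2) ^+ absz n)%:E)%E.
  by rewrite ger0_norm ?sqr_ge0// /weight exprAC.
rewrite /sqsumm /summ; under eq_esum do rewrite fE.
rewrite (esumID (range Posz)); last first.
  by move=> n _; rewrite lee_fin exprn_ge0// sqr_ge0.
have -> : [set: int] `&` range Posz = range Posz by rewrite setTI.
have -> : [set: int] `&` ~` range Posz = range Negz.
  rewrite setTI; apply/seteqP; split=> [[n|n]|[n|n]] //=.
  - by move=> /(_ (ex_intro2 _ _ n I erefl)).
  - by move=> _; exists n.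
  - by case.
  - by move=> _ [].
rewrite !esum_image; last 2 first.
- by move=> i j _ _ [].
- by move=> i j _ _ [].
apply: lte_add_pinfty; first exact: esum_geometric_lty.
(* [absz (Negz n)] is [n.+1], so each term has one extra factor [r ^+ 2 <= 1]. *)
apply: le_lt_trans (esum_geometric_lty _ q01); apply: le_esum => n _.
case/andP: q01 => q0 q1.
by rewrite lee_fin /= exprS ger_pMl ?exprn_gt0// ltW.
Qed.

(** Neighbouring weights have ratio [rho] or [rho^-1], and [1 - rho^-1 <= rho - 1] lets one bound
    cover both. *)
Lemma weight_step (rho : R) (a b : nat) : 1 < rho -> (a = b.+1 \/ b = a.+1)%N ->
  rho^-1 ^+ a <= rho * rho^-1 ^+ b /\
  `|rho^-1 ^+ a - rho^-1 ^+ b| <= (rho - 1) * rho^-1 ^+ b.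
Proof.
move=> rho1; have rho0 : 0 < rho by lra.
have r0 : 0 < rho^-1 by rewrite invr_gt0.
have rr : rho * rho^-1 = 1 by rewrite divff// gt_eqF.
move: (rho^-1) r0 rr => r r0 rr.
case=> ->; rewrite exprS.
- have x0 : 0 <= r ^+ b by rewrite exprn_ge0// ltW.
  move: (r ^+ b) x0 => x x0.
  have r1 : r < 1 by nra.
  split; first by nra.
  rewrite ler0_norm; last by nra.
  have : 1 - r <= rho - 1 by nra.
  by nra.
- have x0 : 0 <= r ^+ a by rewrite exprn_ge0// ltW.
  move: (r ^+ a) x0 => x x0.
  have r1 : r < 1 by nra.
  have -> : rho * (r * x) = x by rewrite mulrA rr mul1r.
  have -> : (rho - 1) * (r * x) = x - r * x by rewrite mulrA mulrBl rr; ring.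
  split=> //; rewrite ger0_norm//; nra.
Qed.

Lemma absz_step (n k : int) : absz k = 1%N ->
  absz (n + k) = (absz n).+1 \/ absz n = (absz (n + k)).+1.
Proof. lia. Qed.

Lemma ip_ge_term (x : int -> R) n : sqsumm x -> x n ^+ 2 <= ip x x.
Proof.
move=> sx; rewrite /ip sumT_ge0E; last by move=> m; rewrite -expr2 sqr_ge0.
rewrite -lee_fin -esum_fineK; last 2 first.
- by move=> m; rewrite -expr2 sqr_ge0.
- by under eq_fun do rewrite -expr2.
apply: esum_ge; exists [set n]; first by split.
by rewrite fsbig_set1 expr2.
Qed.

Variables eps Omega : R.
Hypothesis eps0 : 0 < eps.

Lemma cos_sin_shift (k : R) (n : int) :
  (cos (k * (n + 1)%:~R) + cos (k * (n - 1)%:~R)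
     = 2 * cos k * cos (k * n%:~R)) /\
  (sin (k * (n + 1)%:~R) + sin (k * (n - 1)%:~R)
     = 2 * cos k * sin (k * n%:~R)).
Proof.
rewrite !(rmorphD, rmorphN, rmorph1) /= !mulrDr mulrN mulr1.
by rewrite cosD cosB sinD sinB; split; ring.
Qed.

(** The undamped wave [theta] satisfies the eigenvalue equation exactly, so the error consists only
    of differences of neighbouring weights. *)
Lemma modulated_error (rho cosk : R) (theta : int -> R) n :
  1 < rho -> (forall n, `|theta n| <= 1) ->
  (forall n, theta (n + 1) + theta (n - 1) = 2 * cosk * theta n) ->
  `|chain eps Omega (fun n => weight rho^-1 n * theta n) n
    - (Omega + eps * (2 * cosk - 2)) * (weight rho^-1 n * theta n)|
  <= 2 * eps * (rho - 1) * weight rho^-1 n.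
Proof.
move=> rho1 th1 thE; rewrite /chain.
have [_ w1] := weight_step _ _ _ rho1 (absz_step n 1 erefl).
have [_ w2] := weight_step _ _ _ rho1 (absz_step n (- 1) erefl).
rewrite -![rho^-1 ^+ _]/(weight rho^-1 _) in w1 w2.
have w0 : 0 <= weight rho^-1 n by rewrite exprn_ge0// invr_ge0; lra.
move: (th1 (n + 1)) (th1 (n - 1)) (thE n) w1 w2 w0.
move: (weight rho^-1 (n + 1)) (weight rho^-1 (n - 1)) (weight rho^-1 n).
move: (theta (n + 1)) (theta (n - 1)) (theta n).
move=> t1 t2 t w1 w2 w h1 h2 E k1 k2 w0.
have -> : eps * (w1 * t1 - 2 * (w * t) + w2 * t2) + Omega * (w * t)
    - (Omega + eps * (2 * cosk - 2)) * (w * t)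
    = eps * ((w1 - w) * t1 + (w2 - w) * t2) + eps * w * (t1 + t2 - 2 * cosk * t).
  by ring.
rewrite E subrr mulr0 addr0 normrM gtr0_norm//.
have j1 : `|(w1 - w) * t1| <= (rho - 1) * w * 1 by rewrite normrM ler_pM.
have j2 : `|(w2 - w) * t2| <= (rho - 1) * w * 1 by rewrite normrM ler_pM.
have := ler_wpM2l (ltW eps0) (le_trans (ler_normD _ _) (lerD j1 j2)).
by move/le_trans; apply; lra.
Qed.

(* Of the damped cosine and sine waves, at least one carries half of the mass of
   the envelope [w]. *)
Lemma approximate_eigenvector (lambda delta : R) :
  Omega - 4 * eps <= lambda <= Omega -> 0 < delta ->
  exists (rho : R) (w phi : int -> R),
    [/\ 0 <= rho, forall n, 0 <= w n, forall n, w (n + 1) <= rho * w n,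
        forall n, w (n - 1) <= rho * w n & sqsumm w] /\
    [/\ 0 < ip w w, forall n, `|phi n| <= w n,
        forall n, `|chain eps Omega phi n - lambda * phi n| <= delta * w n
      & ip w w <= 2 * ip phi phi].
Proof.
move=> /andP[l1 l2] d0.
(* Chosen so that the error factor [2 * eps * (rho - 1)] equals [delta]. *)
pose rho := 1 + delta / (2 * eps).
have rho1 : 1 < rho by rewrite ltrDl divr_gt0// mulr_gt0.
have r01 : 0 < rho^-1 < 1.
  have rho0 : 0 < rho by lra.
  by apply/andP; split; rewrite ?invr_gt0 ?invf_lt1.
pose w := weight rho^-1.
have w0 n : 0 <= w n by rewrite exprn_ge0// ltW//; case/andP: r01.
have sw : sqsumm w by exact: sqsumm_weight.
(* The wave number solving [lambda = Omega + eps * (2 * cos k - 2)]; the argument lies in [-1, 1]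
   exactly when [lambda] lies in [[Omega - 4 eps, Omega]]. *)
pose k := acos (1 + (lambda - Omega) / (2 * eps)).
have cosk : cos k = 1 + (lambda - Omega) / (2 * eps).
  rewrite acosK// in_itv/=; apply/andP; split.
  - rewrite -lerBlDl ler_pdivlMr ?mulr_gt0//; lra.
  - rewrite -lerBrDl ler_pdivrMr ?mulr_gt0//; lra.
have lamE : lambda = Omega + eps * (2 * cos k - 2).
  by rewrite cosk; field; rewrite gt_eqF.
have delE : delta = 2 * eps * (rho - 1) by rewrite /rho; field; rewrite gt_eqF.
pose c n := w n * cos (k * n%:~R); pose s n := w n * sin (k * n%:~R).
have cw n : `|c n| <= w n.
  by rewrite normrM (ger0_norm (w0 n)) ler_piMr// cos_max.
have sinw n : `|s n| <= w n.
  by rewrite normrM (ger0_norm (w0 n)) ler_piMr// sin_max.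
have wpos : 0 < ip w w.
  apply: lt_le_trans (ip_ge_term _ 0 sw).
  by rewrite /w /weight expr0 expr1n.
have sc : sqsumm c by apply: sqsumm_le sw => n; rewrite (ger0_norm (w0 n)).
have ss : sqsumm s by apply: sqsumm_le sw => n; rewrite (ger0_norm (w0 n)).
have split_w : ip w w = ip c c + ip s s.
  rewrite /ip -sumTD; try exact: summ_mul.
  apply: eq_sumT => n; rewrite /c /s.
  transitivity (w n * w n * (cos (k * n%:~R) ^+ 2 + sin (k * n%:~R) ^+ 2)).
    by rewrite cos2Dsin2 mulr1.
  by ring.
exists rho, w.
have basics : [/\ 0 <= rho, forall n, 0 <= w n, forall n, w (n + 1) <= rho * w n,
        forall n, w (n - 1) <= rho * w n & sqsumm w].
  split=> //; first lra.
  - by move=> n; have [] := weight_step _ _ _ rho1 (absz_step n 1 erefl).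
  - by move=> n; have [] := weight_step _ _ _ rho1 (absz_step n (- 1) erefl).
have [sc_le|cs_le] := leP (ip s s) (ip c c).
- exists c; split=> //; split=> //; last by rewrite split_w; lra.
  move=> n; rewrite lamE delE; apply: modulated_error => // m.
  + exact: cos_max.
  + exact: (cos_sin_shift k m).1.
- exists s; split=> //; split=> //; last by rewrite split_w; lra.
  move=> n; rewrite lamE delE; apply: modulated_error => // m.
  + exact: sin_max.
  + exact: (cos_sin_shift k m).2.
Qed.

End ApproximateEigenvector.

(** * Growth of the tested components *)

Lemma mvt_ge {R : realType} (f df : R -> R) (t m : R) :
  (forall s, is_derive s (1 : R) f (df s)) -> 0 <= t ->
  (forall s, 0 <= s <= t -> m <= df s) -> f 0 + m * t <= f t.
Proof.
move=> Df t0 dfm.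
have cf : {within `[0, t], continuous f}.
  apply: continuous_subspaceT => s.
  by apply: differentiable_continuous; apply/derivable1_diffP; have [] := Df s.
have [d] := MVT_segment t0 (fun s _ => Df s) cf.
rewrite in_itv/= subr0 => /dfm md E.
by rewrite addrC -lerBrDr E ler_wpM2r.
Qed.

(* [G = s a b] satisfies [G' >= - eta] throughout, hence [G >= 1/2] up to time
   [T]; then [a^2, b^2 >= 1 / (4 N)], so that [G' >= g / (8 N)] there and
   [G T >= 1 + N], although [G <= N]. *)
Lemma no_bounded_hyperbolic {R : realType} (a b e1 e2 : R -> R)
    (p q s g N kappa : R) :
  (forall t, is_derive t (1 : R) a (p * b t + e1 t)) ->
  (forall t, is_derive t (1 : R) b (q * a t + e2 t)) ->
  (forall t, `|e1 t| <= kappa) -> (forall t, `|e2 t| <= kappa) ->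
  (forall t, a t ^+ 2 <= N) -> (forall t, b t ^+ 2 <= N) ->
  1 <= N -> 0 < g -> 32 * N ^+ 3 * kappa <= g ->
  s ^+ 2 = 1 -> 0 <= s * p -> 0 <= s * q -> s * p + s * q = g ->
  s * (a 0 * b 0) = 1 -> False.
Proof.
move=> Da Db e1k e2k aN bN N1 g0 kg s2 sp sq spq G0.
pose G t := s * (a t * b t).
pose G1 t := s * (p * b t ^+ 2 + q * a t ^+ 2 + (e1 t * b t + e2 t * a t)).
have DG t : is_derive t (1 : R) G (G1 t).
  have Dab : is_derive t (1 : R) (fun t => a t * b t)
      (a t * (q * a t + e2 t) + b t * (p * b t + e1 t)).
    exact: is_deriveM (Da t) (Db t).
  have DsG : is_derive t (1 : R) G
      (s * (a t * (q * a t + e2 t) + b t * (p * b t + e1 t))).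
    exact: is_deriveZ.
  by apply: is_derive_eq DsG _; rewrite /G1; ring.
have N0 : 0 < N by lra.
have NN : N <= N ^+ 2 by rewrite expr2; nra.
have ns : `|s| = 1.
  by apply/eqP; rewrite -sqrp_eq1 ?normr_ge0// -normrX s2 normr1.
have norm_le x : x ^+ 2 <= N -> `|x| <= N.
  move=> xN; rewrite -ler_sqr ?nnegrE// ?(ltW N0)//.
  by rewrite real_normK ?num_real//; exact: le_trans xN NN.
(* The error terms total at most [2 * kappa * N], which is below [eta] by the smallness hypothesis
   on [kappa]. *)
pose eta := g / (16 * N ^+ 2).
have errG t : `|s * (e1 t * b t + e2 t * a t)| <= eta.
  rewrite normrM ns mul1r; apply: le_trans (ler_normD _ _) _; rewrite !normrM.
  have h1 := ler_pM (normr_ge0 _) (normr_ge0 _) (e1k t) (norm_le _ (bN t)).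
  have h2 := ler_pM (normr_ge0 _) (normr_ge0 _) (e2k t) (norm_le _ (aN t)).
  apply: le_trans (lerD h1 h2) _; rewrite /eta ler_pdivlMr; last first.
    by rewrite mulr_gt0// exprn_gt0.
  by apply: le_trans kg; rewrite le_eqVlt; apply/orP; left; apply/eqP; ring.
have G1E t : G1 t = s * p * b t ^+ 2 + s * q * a t ^+ 2
    + s * (e1 t * b t + e2 t * a t) by rewrite /G1; ring.
have G1_ge t : - eta <= G1 t.
  have := errG t; rewrite ler_norml => /andP[h _]; rewrite G1E.
  have := mulr_ge0 sp (sqr_ge0 (b t)); have := mulr_ge0 sq (sqr_ge0 (a t)).
  by lra.
(* Balances both estimates: the possible loss [eta * T] is 1/2, and the gain [g / (8 * N) * T] is
   [N]. *)
pose T := 8 * N ^+ 2 / g.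
have T0 : 0 <= T by rewrite divr_ge0// ?ltW// mulr_gt0// exprn_gt0.
have etaT : eta * T = 1 / 2.
  by rewrite /eta /T; field; rewrite !gt_eqF.
have eta0 : 0 <= eta by rewrite divr_ge0 ?ltW// mulr_gt0// exprn_gt0.
have G_half t : 0 <= t <= T -> 1 / 2 <= G t.
  move=> /andP[t0 tT]; have := mvt_ge G G1 t (- eta) DG t0 (fun s _ => G1_ge s).
  rewrite [G 0]G0; have := ler_wpM2l eta0 tT; lra.
have G1_large t : 0 <= t <= T -> g / (8 * N) <= G1 t.
  move=> tT; have Gh := G_half t tT.
  have ab : 1 / 4 <= a t ^+ 2 * b t ^+ 2.
    have -> : a t ^+ 2 * b t ^+ 2 = G t ^+ 2.
      by rewrite /G exprMn s2 mul1r exprMn.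
    by have := mulr_ge0 (_ : 0 <= G t - 1 / 2) (_ : 0 <= G t - 1 / 2); nra.
  have aa : 1 / (4 * N) <= a t ^+ 2.
    rewrite ler_pdivrMr ?mulr_gt0//.
    by have := ler_wpM2l (sqr_ge0 (a t)) (bN t); lra.
  have bb : 1 / (4 * N) <= b t ^+ 2.
    rewrite ler_pdivrMr ?mulr_gt0//.
    by have := ler_wpM2r (sqr_ge0 (b t)) (aN t); lra.
  have := errG t; rewrite ler_norml => /andP[h _]; rewrite G1E.
  have h1 := ler_wpM2l sp bb; have h2 := ler_wpM2l sq aa.
  (* The error is absorbed by half of the main term since [2 * N >= 1]. *)
  have : g / (8 * N) + eta <= g * (1 / (4 * N)).
    rewrite -subr_ge0.
    have -> : g * (1 / (4 * N)) - (g / (8 * N) + eta)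
      = g * (2 * N - 1) / (16 * N ^+ 2).
      by rewrite /eta; field; rewrite gt_eqF.
    rewrite divr_ge0// ?mulr_ge0 ?exprn_ge0// ?ltW//; lra.
  rewrite -spq mulrDl; lra.
have := mvt_ge G G1 T _ DG T0 G1_large; rewrite [G 0]G0.
have -> : g / (8 * N) * T = N by rewrite /T; field; rewrite !gt_eqF.
have : G T <= N.
  apply: le_trans (ler_norm _) _; rewrite /G normrM ns mul1r normrM.
  have := aN T; have := bN T.
  rewrite -(real_normK (num_real (a T))) -(real_normK (num_real (b T))).
  move: (`|a T|) (`|b T|) => x y.
  by have := sqr_ge0 (x - y); nra.
lra.
Qed.

(** * Instability by testing against an approximate eigenvector *)

Section Instability.
Context {R : realType}.
Variables eps Omega gamma : R.

Lemma stable_chain_bound : zero_linearly_stable eps Omega gamma ->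
  exists K : R, forall u v, chain_solution eps Omega (2 * gamma) u v ->
  forall t, ip (u t) (u t) + ip (v t) (v t)
    <= K ^+ 2 * (ip (u 0) (u 0) + ip (v 0) (v 0)).
Proof.
move=> [K stab]; exists K => u v sol t.
pose A t n := Complex (u t n) (v t n).
have lin := chain_linearized _ _ _ _ _ sol.
have sA s : in_l2 (A s) by have [] := lin.1 s.
have sNA s : in_l2 ((- A) s) by have [] := lin.1 s.
have nA s : l2norm (A s) ^+ 2 = ip (u s) (u s) + ip (v s) (v s).
  exact: sqr_l2norm.
have nNA s : l2norm ((- A) s) = l2norm (A s).
  have e : l2norm ((- A) s) ^+ 2 = l2norm (A s) ^+ 2.
    rewrite sqr_l2norm// nA -[rep _]/(- u s) -[imp _]/(- v s).
    by rewrite !ipNl !ipNr !opprK.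
  by move/eqP: e; rewrite eqrXn2 ?l2norm_ge0// => /eqP.
have := stab _ _ lin t; rewrite -/A !nNA -!nA => le1.
have le2 : l2norm (A t) <= K * l2norm (A 0) by lra.
(* The sign of [K] is unknown; the right-hand side is nonnegative because it dominates a norm. *)
have := lerXn2r 2 (l2norm_ge0 _) (le_trans (l2norm_ge0 _) le2) le2.
by rewrite exprMn.
Qed.

Lemma linearly_unstable (lambda : R) : 0 < eps ->
  Omega - 4 * eps <= lambda <= Omega -> `|lambda| <= 2 * `|gamma| ->
  gamma != 0 -> zero_linearly_unstable eps Omega gamma.
Proof.
move=> eps0 lamO lamg g0 /stable_chain_bound[K stab].
(* Stability bounds the squares of the tested components by [2 * K ^+ 2]; adding 1 ensures [1 <= N].
   The rates [2 * gamma + lambda] and [2 * gamma - lambda], multiplied by the sign of [gamma], add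
   up to [g]. *)
pose N := 2 * K ^+ 2 + 1; pose g := 4 * `|gamma|.
have K0 : 0 <= K ^+ 2 by exact: sqr_ge0.
have N1 : 1 <= N by rewrite /N; lra.
have gpos : 0 < g by rewrite mulr_gt0// normr_gt0.
have N0 : 0 < N by lra.
(* Makes [32 * N ^+ 3 * kappa] equal to [g] for [kappa = 2 * N * delta]. *)
pose delta := g / (64 * N ^+ 4).
have d0 : 0 < delta by rewrite divr_gt0// mulr_gt0// exprn_gt0.
have [rho [w [phi [[rho0 w0 w1 w2 sw] [wpos phiw err Wphi]]]]] :=
  approximate_eigenvector eps Omega eps0 lambda delta lamO d0.
pose s := Num.sg gamma.
have s2 : s ^+ 2 = 1 by rewrite sqr_sg g0.
have ns : `|s| = 1 by rewrite normr_sg g0.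
have sg_gamma : s * gamma = `|gamma| by rewrite /s -normrEsg.
have sphi : sqsumm phi.
  by apply: sqsumm_le sw => n; rewrite (ger0_norm (w0 n)).
have sphiw n : `|(s *: phi) n| <= w n.
  by rewrite -[(s *: phi) n]/(s * phi n) normrM ns mul1r.
(* Starting from [phi] and [s *: phi] aligns the data with the growing direction: [s * (a 0 * b 0)]
   is 1 after normalization by [Phi]. *)
have [u [v [sol u0 v0]]] := chain_solution_exists eps Omega (2 * gamma) rho w
  rho0 w0 w1 w2 sw phi (s *: phi) phiw sphiw.
have bound := stab _ _ sol; move: sol => [su sv du dv].
pose Phi := ip phi phi.
have Phi0 : 0 < Phi by rewrite /Phi; lra.
have {}bound t : ip (u t) (u t) + ip (v t) (v t) <= 2 * K ^+ 2 * Phi.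
  apply: le_trans (bound t) _; rewrite u0 v0 ipZl// ?ipZr//; last exact: sqsummZ.
  by rewrite mulrA -expr2 s2 -/Phi; lra.
pose eta := chain eps Omega phi - lambda *: phi.
have schain : sqsumm (chain eps Omega phi) by exact: sqsumm_chain.
have slam : sqsumm (lambda *: phi) by exact: sqsummZ.
have seta : sqsumm eta by exact: sqsummB.
have etaN : ip eta eta <= 2 * delta ^+ 2 * Phi.
  apply: le_trans (_ : ip (delta *: w) (delta *: w) <= _).
    apply: ler_ip; last exact: sqsummZ.
    move=> n; apply: le_trans (err n) _; exact: ler_norm.
  rewrite ipZl ?ipZr//; last exact: sqsummZ.
  by have := ler_wpM2l (sqr_ge0 delta) Wphi; rewrite -/Phi; lra.
(* By self-adjointness <L x, phi> = lambda <x, phi> + <x, eta>, so the residual [eta] produces the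
   error terms [e1] and [e2]. *)
pose a t := ip (u t) phi / Phi; pose b t := ip (v t) phi / Phi.
pose e1 t := ip (v t) eta / Phi; pose e2 t := - (ip (u t) eta / Phi).
(* Used with [y = phi], [B = 1] for the components and with [y = eta], [B = 2 * delta ^+ 2] for the
   errors. *)
have quot_sqr (x y : int -> R) (B : R) : sqsumm x -> sqsumm y ->
    ip x x <= 2 * K ^+ 2 * Phi -> ip y y <= B * Phi ->
    (ip x y / Phi) ^+ 2 <= N * B.
  move=> sx sy xK yB; rewrite expr_div_n ler_pdivrMr ?exprn_gt0//.
  apply: le_trans (ip_sqr_le _ _ sx sy) _.
  apply: le_trans (ler_pM (ip_ge0 _) (ip_ge0 _) xK yB) _.
  have B0 : 0 <= B by have := le_trans (ip_ge0 y) yB; rewrite pmulr_lge0.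
  have : 0 <= B * Phi ^+ 2 by rewrite mulr_ge0// sqr_ge0.
  by rewrite /N; lra.
have uK t : ip (u t) (u t) <= 2 * K ^+ 2 * Phi.
  by have := bound t; have := ip_ge0 (v t); lra.
have vK t : ip (v t) (v t) <= 2 * K ^+ 2 * Phi.
  by have := bound t; have := ip_ge0 (u t); lra.
have phi1 : ip phi phi <= 1 * Phi by rewrite mul1r.
(* A bound for the square root of [2 * N * delta ^+ 2], valid since [1 <= N]. *)
pose kappa := 2 * N * delta.
have kappa_le x : x ^+ 2 <= N * (2 * delta ^+ 2) -> `|x| <= kappa.
  have k0 : 0 <= kappa by apply: mulr_ge0; [lra|exact: ltW].
  move=> xle; rewrite -ler_sqr ?nnegrE// real_normK ?num_real//.
  apply: le_trans xle _.
  have -> : kappa ^+ 2 = 4 * N ^+ 2 * delta ^+ 2 by rewrite /kappa; ring.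
  have := sqr_ge0 delta; move: (delta ^+ 2) => d d2.
  have : N <= N ^+ 2 by nra.
  by move=> NN; have := ler_wpM2r d2 NN; have := mulr_ge0 (sqr_ge0 N) d2; lra.
have dip (f : R -> int -> R) x t : (forall s, sqsumm (f s)) -> dl2 f t x ->
    is_derive t (1 : R) (fun s => ip (f s) phi / Phi) (ip x phi / Phi).
  move=> sf df.
  have D := is_derive_ip f (fun=> phi) t x 0 sf (fun=> sphi) df (dl2_cst phi t).
  have Z0 : ip (f t) 0 = 0 by rewrite -(scale0r phi) ipZr// mul0r.
  have DZ : is_derive t (1 : R) (fun s => ip (f s) phi / Phi)
      (Phi^-1 * (ip x phi + ip (f t) 0)).
    have -> : (fun s => ip (f s) phi / Phi) = Phi^-1 *: (fun s => ip (f s) phi).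
      by apply/funext => r; rewrite mulrC.
    exact: is_deriveZ.
  by apply: is_derive_eq DZ _; rewrite Z0 addr0 mulrC.
have chain_phi : chain eps Omega phi = lambda *: phi + eta.
  by rewrite /eta addrC subrK.
have ip_chainC x : sqsumm x ->
    ip (chain eps Omega x) phi = lambda * ip x phi + ip x eta.
  (* Moves [chain] from [x] to [phi] through the symmetric formula [ip_chain]. *)
  move=> sx; rewrite ipC ip_chain// (ipC phi) (ipC (shift1 phi)) (ipC phi) addrC.
  rewrite [ip (shift1 x) phi + _]addrC addrC -ip_chain// chain_phi.
  by rewrite ipDr// ipZr.
have Da t : is_derive t (1 : R) a ((lambda + 2 * gamma) * b t + e1 t).
  have := dip u _ t su (du t); move/is_derive_eq; apply.
  have s1 : sqsumm (chain eps Omega (v t)) by exact: sqsumm_chain.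
  have s3 : sqsumm ((2 * gamma) *: v t) by exact: sqsummZ.
  by rewrite ipDl// ipZl// ip_chainC// /b /e1; field; rewrite gt_eqF.
have Db t : is_derive t (1 : R) b ((2 * gamma - lambda) * a t + e2 t).
  have := dip v _ t sv (dv t); move/is_derive_eq; apply.
  have s1 : sqsumm (- chain eps Omega (u t)) by exact/sqsummN/sqsumm_chain.
  have s3 : sqsumm ((2 * gamma) *: u t) by exact: sqsummZ.
  by rewrite ipDl// ipNl ipZl// ip_chainC// /a /e2; field; rewrite gt_eqF.
have s_lam : `|s * lambda| <= 2 * `|gamma| by rewrite normrM ns mul1r.
move: s_lam; rewrite ler_norml => /andP[sl1 sl2].
apply: (no_bounded_hyperbolic a b e1 e2 _ _ s g N kappa Da Db) => //.
- by move=> t; apply: kappa_le; exact: quot_sqr.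
- by move=> t; apply: kappa_le; rewrite /e2 sqrrN; exact: quot_sqr.
- by move=> t; rewrite -[N]mulr1; exact: quot_sqr.
- by move=> t; rewrite -[N]mulr1; exact: quot_sqr.
- rewrite /kappa /delta le_eqVlt; apply/orP; left; apply/eqP.
  by field; rewrite gt_eqF.
- by rewrite mulrDr mulrCA sg_gamma; lra.
- by rewrite mulrBr mulrCA sg_gamma; lra.
- rewrite mulrDr mulrBr [s * (2 * gamma)]mulrCA sg_gamma /g; ring.
- rewrite /a /b u0 v0 ipZl// -/Phi.
  have -> : s * (Phi / Phi * (s * Phi / Phi)) = s ^+ 2 by field; rewrite gt_eqF.
  exact: s2.
Qed.

End Instability.

(* The three parameter regimes *)
Local Close Scope classical_set_scope.

Theorem lemma1 (R : realType) (eps Omega gamma : R) (heps : 0 < eps) :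
  [/\ Omega \notin `[0, 4 * eps] -> `|gamma| < gamma0 eps Omega ->
        zero_linearly_stable eps Omega gamma,
      Omega \notin `[0, 4 * eps] -> gamma0 eps Omega <= `|gamma| ->
        zero_linearly_unstable eps Omega gamma
    & Omega \in `[0, 4 * eps] -> gamma != 0 ->
        zero_linearly_unstable eps Omega gamma].
Proof.
(* The equation with [false] selects the second branch of [gamma0]. *)
have out : Omega \notin `[0, 4 * eps] ->
    4 * eps < Omega \/ Omega < 0 /\ (4 * eps < Omega) = false.
  rewrite in_itv/= negb_and -2!ltNge => /orP[lt0O|gtO]; last by left.
  by right; split=> //; apply/negbTE; rewrite -leNgt; lra.
split.
- move=> /out[gtO|[ltO leO]]; rewrite /gamma0.
  + rewrite gtO => g_lt.
    (* The spectrum is positive: its lower edge less [2 * |gamma|] and its upper edge plus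
       [2 * |gamma|]. The other stable case is the mirror image. *)
    apply: (linearly_stable _ _ _ (Omega - 4 * eps - 2 * `|gamma|)
      (Omega + 2 * `|gamma|)).
    * exact: ltW.
    * lra.
    * by left; split; lra.
  + rewrite leO (ltr0_norm ltO) => g_lt.
    apply: (linearly_stable _ _ _ (- Omega - 2 * `|gamma|)
      (4 * eps - Omega + 2 * `|gamma|)).
    * exact: ltW.
    * lra.
    * by right; split; lra.
- move=> /out[gtO|[ltO leO]]; rewrite /gamma0.
  + rewrite gtO => g_ge.
    (* The spectral edge nearest to 0, of modulus [2 * gamma0]; for negative [Omega] that edge is
       [Omega] itself. *)
    apply: (linearly_unstable _ _ _ (Omega - 4 * eps)) => //.
    * by apply/andP; split; lra.
    * by rewrite gtr0_norm; lra.
    * by rewrite -normr_gt0; lra.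
  + rewrite leO (ltr0_norm ltO) => g_ge.
    apply: (linearly_unstable _ _ _ Omega) => //.
    * by apply/andP; split; lra.
    * by rewrite (ltr0_norm ltO); lra.
    * by rewrite -normr_gt0; lra.
- rewrite in_itv/= => /andP[lt0O O4] g0.
  (* Here 0 belongs to the spectrum, so every nonzero coupling destabilizes. *)
  apply: (linearly_unstable _ _ _ 0) => //.
  * by apply/andP; split; lra.
  * by rewrite normr0 mulr_ge0.
Qed.
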